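(* Let $\Lambda$ be a set of monotone predicate liftings for a set functor $\mathsf{T}$. For every monotone $P$-chromatic $\mathtt{1SO}_\Lambda$-automaton $\mathbb{A}$ there exists a non-deterministic $P$-chromatic $\mathtt{1SO}_\Lambda$-automaton $\mathbb{A}'$ that accepts exactly the same $\mathsf{T}$-tree models as $\mathbb{A}$.
   Context: Set functors are endofunctors on sets assumed to map injective maps to injective maps; $\mathcal{Q}$ is the contravariant powerset functor; a (monotone) $n$-place predicate lifting is a natural transformation $\lambda:\mathcal{Q}^n\to\mathcal{Q}\circ\mathsf{T}$ (with $\lambda_X(Y_1,\dots,Y_n)\subseteq\lambda_X(Z_1,\dots,Z_n)$ whenever $Y_i\subseteq Z_i$). $\mathit{Var}$ is a fixed infinite set of variables; a $\mathsf{T}$-model is $(S,\sigma,V)$, $\sigma:S\to\mathsf{T}S$, $V:\mathit{Var}\to\mathcal{P}S$, $V^\dagger(s)=\{p\mid s\in V(p)\}$. $X\subseteq S$ supports $\alpha\in\mathsf{T}S$ if $\alpha=\mathsf{T}\iota(\beta)$ for some (unique) $\beta=:\alpha|_X\in\mathsf{T}X$, $\iota$ the inclusion. A $\mathsf{T}$-tree model $(S,R,\sigma,V,u)$: a $\mathsf{T}$-model with $R\subseteq S\times S$ such that each $R(s)$ supports $\sigma(s)$ and $(S,R)$ is a tree rooted at $u$. For finite $A$, a one-step model is $(X,\alpha,V)$, $\alpha\in\mathsf{T}X$, $V:A\to\mathcal{P}X$. Second-order one-step formulas $\varphi::=a\subseteq b\mid\lambda(a_1,\dots,a_n)\mid\neg\varphi\mid\varphi\vee\varphi\mid\exists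 a.\varphi$ ($\lambda\in\Lambda$, variables from $A$ and an auxiliary infinite set) with the evident semantics ($V(a)\subseteq V(b)$; $\alpha\in\lambda_X(V(a_1),\dots,V(a_n))$; Booleans; existential quantification over subsets of $X$). $\mathtt{1SO}_\Lambda(A)$: those with free variables in $A$. A formula $\varphi\in\mathtt{1SO}_\Lambda(A)$ is monotone if $(X,\alpha,V)\Vdash_1\varphi$ and $V(a)\subseteq V'(a)$ for all $a$ imply $(X,\alpha,V')\Vdash_1\varphi$; it is disjunctive if whenever $(X,\alpha,V)\Vdash_1\varphi$ there is $V^*:A\to\mathcal{P}X$ with $V^*(a)\subseteq V(a)$ for all $a$, $V^*(a)\cap V^*(b)=\emptyset$ for $a\neq b$, and $(X,\alpha,V^* )\Vdash_1\varphi$. A $P$-chromatic $\mathtt{1SO}_\Lambda$-automaton ($P\subseteq\mathit{Var}$ finite) is $(A,\Delta,\Omega,a_I)$, $A$ finite, $a_I\in A$, $\Omega:A\to\omega$, $\Delta:A\times\mathcal{P}(P)\to\mathtt{1SO}_\Lambda(A)$; it is monotone if every $\Delta(a,c)$ is monotone and non-deterministic if every $\Delta(a,c)$ is disjunctive. Acceptance game on a tree model $(S,R,\sigma,V,u)$: at $(a,s)$ (priority $\Omega(a)$) $\exists$ picks $U:A\to\mathcal{P}(R(s))$ with $(R(s),\sigma(s)|_{R(s)},U)\Vdash_1\Delta(a,V^\dagger(s)\cap P)$; at $U$ (priority 0) $\forall$ picks $(b,t)$ with $t\in U(b)$; a stuck player loses; infinite matches are won by $\exists$ iff the greatest priority occurring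 infinitely often is even. Acceptance: $\exists$ wins from $(a_I,u)$. *)

(* Defs.v *)
(* MathComp, with the classical sets of MathComp-Analysis. *)
From Stdlib Require Import Relation_Operators.
From mathcomp Require Import all_boot.
From mathcomp Require Import boolp classical_sets functions cardinality.

Set Implicit Arguments.
Unset Strict Implicit.
Unset Printing Implicit Defensive.

Local Open Scope classical_set_scope.

(* The category of sets: fixing one universe makes functors, liftings, one-step
   models and tree models range over the same sets. *)
Definition Sets := Type.

Record set_functor := SetFunctor {
  fobj :> Sets -> Sets;
  fmap : forall X Y : Sets, (X -> Y) -> fobj X -> fobj Y;
  fmap_id : forall X : Sets, fmap (@id X) = id;
  fmap_comp : forall (X Y Z : Sets) (g : Y -> Z) (f : X -> Y),
    fmap (g \o f) = fmap g \o fmap f;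
  fmap_inj : forall (X Y : Sets) (f : X -> Y),
    injective f -> injective (fmap f) }.

Arguments fmap T {X Y} f _ : rename.

Record predicate_lifting (T : set_functor) (n : nat) := PredicateLifting {
  lift_app :> forall X : Sets, ('I_n -> set X) -> set (T X);
  lift_natural : forall (X Y : Sets) (f : X -> Y) (W : 'I_n -> set Y),
    lift_app (fun i => f @^-1` W i) = fmap T f @^-1` lift_app W }.

Definition monotone_lifting (T : set_functor) (n : nat)
    (l : predicate_lifting T n) : Prop :=
  forall (X : Sets) (Y Z : 'I_n -> set X),
    (forall i, Y i `<=` Z i) -> l X Y `<=` l X Z.

(* A set of predicate liftings, given as the range of a family. *)
Record lifting_set (T : set_functor) := LiftingSet {
  lsym :> Type;
  arity : lsym -> nat;
  lifting : forall l : lsym, predicate_lifting T (arity l) }.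

Section OneStepFormulas.
Variables (T : set_functor) (Lam : lifting_set T).

Inductive formula (var : Type) : Type :=
| FSub (a b : var)
| FLift (l : Lam) (a : 'I_(arity l) -> var)
| FNeg (f : formula var)
| FOr (f g : formula var)
| FEx (a : var) (f : formula var).

Definition update (var : eqType) (X : Sets) (V : var -> set X) (a : var)
    (Y : set X) : var -> set X :=
  fun b => if b == a then Y else V b.

Fixpoint sat (var : eqType) (X : Sets) (alpha : T X) (V : var -> set X)
    (f : formula var) : Prop :=
  match f with
  | FSub a b => V a `<=` V b
  | FLift l a => lifting l X (fun i => V (a i)) alpha
  | FNeg g => ~ sat alpha V g
  | FOr g h => sat alpha V g \/ sat alpha V h
  | FEx a g => exists Y : set X, sat alpha (update V a Y) g
  end.

Fixpoint free (var : Type) (f : formula var) : set var :=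
  match f with
  | FSub a b => [set a; b]
  | FLift _ a => range a
  | FNeg g => free g
  | FOr g h => free g `|` free h
  | FEx a g => free g `\ a
  end.

(* Variables are drawn from A and from the auxiliary set Aux. *)
Record so1 (Aux A : eqType) := SO1 {
  so1_formula :> formula (A + Aux)%type;
  so1_free : free so1_formula `<=` range inl }.

Variables (Aux A : eqType).

(* The auxiliary variables do not occur freely, so their value is irrelevant. *)
Definition extend (X : Sets) (V : A -> set X) : (A + Aux)%type -> set X :=
  fun x => match x with inl a => V a | inr _ => set0 end.

Definition sat1 (X : Sets) (alpha : T X) (V : A -> set X) (f : so1 Aux A) :
    Prop :=
  sat alpha (extend V) f.

Definition monotone_so1 (f : so1 Aux A) : Prop :=
  forall (X : Sets) (alpha : T X) (V V' : A -> set X),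
    sat1 alpha V f -> (forall a, V a `<=` V' a) -> sat1 alpha V' f.

Definition disjunctive_so1 (f : so1 Aux A) : Prop :=
  forall (X : Sets) (alpha : T X) (V : A -> set X),
    sat1 alpha V f ->
    exists Vs : A -> set X,
      [/\ forall a, Vs a `<=` V a,
          forall a b, a <> b -> Vs a `&` Vs b = set0
        & sat1 alpha Vs f].

End OneStepFormulas.

(* A colour, i.e. a subset of P, is a set of elements of P seen as a type. *)
Record automaton (T : set_functor) (Lam : lifting_set T) (Aux : eqType)
    (Var : Type) (P : set Var) := Automaton {
  state : finType;
  delta : state -> set P -> so1 Lam Aux state;
  Omega : state -> nat;
  init : state }.

Definition monotone_automaton (T : set_functor) (Lam : lifting_set T)
    (Aux : eqType) (Var : Type) (P : set Var) (AA : automaton Lam Aux P) :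
    Prop :=
  forall (a : state AA) (c : set P), monotone_so1 (delta a c).

Definition nondeterministic (T : set_functor) (Lam : lifting_set T)
    (Aux : eqType) (Var : Type) (P : set Var) (AA : automaton Lam Aux P) :
    Prop :=
  forall (a : state AA) (c : set P), disjunctive_so1 (delta a c).

Definition supports (T : set_functor) (S : Sets) (X : set S) (alpha : T S) :
    Prop :=
  exists beta : T X, alpha = fmap T (val : X -> S) beta.

Definition restr (T : set_functor) (S : Sets) (X : set S) (alpha : T S)
    (h : supports X alpha) : T X :=
  projT1 (cid h).

Definition is_tree (S : Sets) (R : S -> set S) (u : S) : Prop :=
  [/\ forall s, clos_refl_trans S R u s,
      forall s, ~ R s u
    & forall s s' t, R s t -> R s' t -> s = s'].

Record tree_model (T : set_functor) (Var : Type) := TreeModel {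
  carrier : Sets;
  succ : carrier -> set carrier;
  coalg : carrier -> T carrier;
  valuation : Var -> set carrier;
  tree_root : carrier;
  succ_supports : forall s, supports (succ s) (coalg s);
  succ_tree : is_tree succ tree_root }.

Arguments valuation {T Var} M _ _ : rename.

Record parity_game := ParityGame {
  position : Type;
  eloise : position -> bool;
  moves : position -> set position;
  priority : position -> nat }.

Section Games.
Variable G : parity_game.

(* A strategy maps the partial match played so far to the next position; only
   its values on partial matches ending in a position of eloise matter. *)
Definition strategy := seq (position G) -> position G.

(* The first n moves of rho form a partial match from p guided by f. *)
Definition guided (f : strategy) (p : position G) (rho : nat -> position G)
    (n : nat) : Prop :=
  rho 0 = p /\
  forall i, i < n ->
    moves (rho i) (rho i.+1) /\
    (eloise (rho i) -> rho i.+1 = f (mkseq rho i.+1)).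

Definition infinitely_often (rho : nat -> position G) (k : nat) : Prop :=
  forall n, exists2 m, n <= m & priority (rho m) = k.

Definition parity_won (rho : nat -> position G) : Prop :=
  exists k, [/\ ~~ odd k, infinitely_often rho k
              & forall j, infinitely_often rho j -> j <= k].

(* The first condition also says that eloise is never stuck in a guided match;
   finite maximal matches then end with her opponent being stuck. *)
Definition winning_strategy (f : strategy) (p : position G) : Prop :=
  (forall rho n, guided f p rho n -> eloise (rho n) ->
     moves (rho n) (f (mkseq rho n.+1))) /\
  (forall rho, (forall n, guided f p rho n) -> parity_won rho).

Definition eloise_wins (p : position G) : Prop :=
  exists f : strategy, winning_strategy f p.

End Games.

Section Acceptance.
Variables (T : set_functor) (Lam : lifting_set T) (Aux : eqType) (Var : Type).
Variables (P : set Var) (AA : automaton Lam Aux P) (M : tree_model T Var).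

Definition colour (s : carrier M) : set P :=
  [set p : P | valuation M (val p) s].

(* Positions (a, s) belong to eloise, positions U : A -> P(R(s)) to her
   opponent. *)
Definition acc_position : Type :=
  (state AA * carrier M) + {s : carrier M & state AA -> set (succ s)}.

Definition acc_eloise (q : acc_position) : bool :=
  match q with inl _ => true | inr _ => false end.

Definition acc_moves (q : acc_position) : set acc_position :=
  match q with
  | inl (a, s) =>
      [set q' | exists2 U : state AA -> set (succ s),
         sat1 (restr (succ_supports s)) U (delta a (colour s))
         & q' = inr (existT _ s U)]
  | inr (existT s U) =>
      [set q' | exists b (t : succ s), U b t /\ q' = inl (b, val t)]
  end.

Definition acc_priority (q : acc_position) : nat :=
  match q with inl (a, _) => Omega a | inr _ => 0 end.

Definition acceptance_game : parity_game :=
  ParityGame acc_eloise acc_moves acc_priority.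

Definition accepts : Prop :=
  @eloise_wins acceptance_game (inl (init AA, tree_root M)).

End Acceptance.

(* Main.v *)
(* A winning strategy of eloise in the acceptance game of the given automaton A
   unfolds into a tree of matches. Ordinal ranks of that tree, one for each odd
   priority k, are compared lexicographically; playing at every position as in a
   match of least rank gives a positional winning strategy, together with
   preorders <=_k that decrease weakly along moves from priorities at most k and
   strictly along moves from priority k.

   The simulating automaton guesses, at each node of the tree, the set of moves
   of A that this strategy uses and the position of each state of A in the
   preorders <=_k of that node. Between consecutive nodes, it guesses the map
   sending a position i to the number of states that are below the state at
   position i, and whether this is a strict descent (a flash). Then the positions
   travelled along iterations of these maps, called tokens, flash infinitely often
   only if there is an infinite descent, whereas a match of A of odd maximal
   priority yields a token that flashes infinitely often. As tokens only merge,
   a latest appearance record turns the absence of tokens with infinitely many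
   flashes into a parity condition; this replaces the determinization of
   omega-automata. The transition formulas state that the guessed sets of nodes
   are pairwise disjoint, which makes them trivially disjunctive. *)

Require Import Defs.
From mathcomp Require Import all_boot.
From mathcomp Require Import boolp classical_sets functions cardinality.
From mathcomp Require Import zify.

Set Implicit Arguments.
Unset Strict Implicit.
Unset Printing Implicit Defensive.

Local Open Scope classical_set_scope.

(** * Recurrence and the parity condition *)

Lemma dependent_choice (Z : Type) (I : Z -> Prop) (S : Z -> Z -> Prop) (z0 : Z) :
  I z0 -> (forall z, I z -> exists2 z', I z' & S z z') ->
  exists zs : nat -> Z,
    zs 0 = z0 /\ forall i, I (zs i) /\ S (zs i) (zs i.+1).
Proof.
move=> Iz0 step.
have /choice[nx nxP] z : exists z', I z -> I z' /\ S z z'.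
  have [/step[z' Iz' Szz']|nIz] := pselect (I z); first by exists z'.
  by exists z.
exists (fun i => iter i nx z0); split=> // i.
have Ii : I (iter i nx z0) by elim: i => //= i /nxP[].
by split=> //=; have [] := nxP _ Ii.
Qed.

Definition recurrent (P : nat -> Prop) : Prop :=
  forall n, exists2 m, n <= m & P m.

Definition parity_seq (p : nat -> nat) : Prop :=
  exists k, [/\ ~~ odd k, recurrent (fun i => p i = k)
              & forall j, recurrent (fun i => p i = j) -> j <= k].

Lemma not_recurrent (P : nat -> Prop) :
  ~ recurrent P <-> exists n, forall m, n <= m -> ~ P m.
Proof.
split=> [|[n nP] rP]; last by have [m nm Pm] := rP n; exact: nP nm Pm.
move=> /existsNP[n nP]; exists n => m nm Pm; apply: nP; by exists m.
Qed.

Lemma recurrent_shift (P : nat -> Prop) (c : nat) :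
  recurrent (fun i => P (c + i)) <-> recurrent P.
Proof.
split=> rP n.
  by have [m nm Pm] := rP n; exists (c + m) => //; lia.
by have [m nm Pm] := rP (c + n); exists (m - c); [lia|rewrite subnKC //; lia].
Qed.

Lemma parity_seq_shift (p : nat -> nat) (c : nat) :
  parity_seq (fun i => p (c + i)) <-> parity_seq p.
Proof.
have eqr j := recurrent_shift (fun i => p i = j) c.
by split=> -[k [ek /eqr rk maxk]]; exists k; split=> // j /eqr; exact: maxk.
Qed.

Lemma recurrent_max (p : nat -> nat) (D : nat) :
  (forall i, p i < D) ->
  exists k, [/\ k < D, recurrent (fun i => p i = k)
              & exists N, forall i, N <= i -> p i <= k].
Proof.
move=> pD; have {pD} : exists N, forall i, N <= i -> p i < D by exists 0.
elim: D => [[N /(_ N (leqnn N))]//|D IH [N pN]].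
have [rD|/not_recurrent[N' pN']] := pselect (recurrent (fun i => p i = D)).
  by exists D; split=> //; exists N.
case: IH => [|k [kD rk bk]]; last by exists k; split=> //; lia.
exists (maxn N N') => i; rewrite geq_max => /andP[/pN piD /pN' pinD]; lia.
Qed.

Lemma recurrent_le (p : nat -> nat) (k N j : nat) :
  (forall i, N <= i -> p i <= k) -> recurrent (fun i => p i = j) -> j <= k.
Proof. by move=> pk /(_ N)[m /pk ? <-]. Qed.

(** A bounded sequence has a greatest recurrent value, which bounds it from some index on; only an
    odd one can violate the parity condition. *)
Lemma parity_seqP (p : nat -> nat) (D : nat) :
  (forall i, p i < D) ->
  (forall k N, odd k -> recurrent (fun i => p i = k) ->
     (forall i, N <= i -> p i <= k) -> False) ->
  parity_seq p.
Proof.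
move=> pD odd_false; have [k [_ rk [N pk]]] := recurrent_max pD.
exists k; split=> [|//|j]; last exact: recurrent_le pk.
by apply/negP => ok; exact: odd_false ok rk pk.
Qed.

Lemma parity_seq_odd (p : nat -> nat) (k N : nat) :
  parity_seq p -> odd k -> recurrent (fun i => p i = k) ->
  (forall i, N <= i -> p i <= k) -> False.
Proof.
move=> [l [el rl maxl]] ok rk pk.
have kl := maxl _ rk; have lk := recurrent_le pk rl.
by move: ok el; rewrite (_ : k = l) => [->|]; lia.
Qed.

Lemma recurrent_interleave (p q : nat -> nat) (k : nat) :
  (forall i, p i.*2 = q i) -> (forall i, p i.*2.+1 = 0) -> 0 < k ->
  recurrent (fun i => p i = k) <-> recurrent (fun i => q i = k).
Proof.
move=> pq p0 k0; split=> rk n; last first.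
  by have [m nm <-] := rk n; exists m.*2; [lia|].
have [m nm pm] := rk n.*2; exists m./2; first by lia.
have := odd_double_half m; case: (odd m); rewrite ?add0n => em; last by rewrite -pq em.
by move: k0; rewrite -pm -em add1n p0.
Qed.

(** In a match, positions of priority [q i] alternate with opponent positions of priority 0; as 0 is
    even and least, inserting it does not change the winner. *)
Lemma parity_seq_interleave (p q : nat -> nat) (D : nat) :
  (forall i, p i.*2 = q i) -> (forall i, p i.*2.+1 = 0) -> (forall i, q i < D) ->
  parity_seq p <-> parity_seq q.
Proof.
move=> pq p0 qD; split=> [pp|].
  apply: (parity_seqP qD) => k N ok rk qk.
  have k0 : 0 < k by case: k ok {rk qk}.
  apply: (@parity_seq_odd p k N.*2 pp ok).
    exact/(recurrent_interleave pq p0 k0).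
  move=> i Ni; have := odd_double_half i; case: (odd i); rewrite ?add0n => ei.
    by rewrite -ei add1n p0.
  by rewrite -ei pq qk //; lia.
move=> [k [ek rk maxk]]; exists k; split=> // [n|j].
  by have [m nm <-] := rk n; exists m.*2; [lia|].
by case: j => // j /(recurrent_interleave pq p0 (ltn0Sn j)); exact: maxk.
Qed.

(** * Ranks of a graph satisfying the parity condition *)

(** Stands for a comparison of ordinal values. Reflexivity and totality come from least elements of
    sets of one and two elements. *)
Definition well_preorder (N : Type) (r : N -> N -> Prop) : Prop :=
  (forall x y z, r x y -> r y z -> r x z) /\
  (forall P : N -> Prop, (exists x, P x) ->
     exists2 x, P x & forall y, P y -> r x y).

Section WellPreorder.
Variables (N : Type) (r : N -> N -> Prop) (wr : well_preorder r).

Lemma well_preorder_total (x y : N) : r x y \/ r y x.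
Proof.
have [|z [->|->] zP] := wr.2 (fun z => z = x \/ z = y); first by exists x; left.
  by left; apply: zP; right.
by right; apply: zP; left.
Qed.

Lemma well_preorder_refl (x : N) : r x x.
Proof. by case: (well_preorder_total x x). Qed.

Lemma well_preorder_preimage (K : Type) (f : K -> N) :
  well_preorder (fun x y => r (f x) (f y)).
Proof.
split=> [x y z|P [x Px]]; first exact: wr.1.
have [|_ [y Py <-] yP] := wr.2 (f @` P); first by exists (f x); exists x.
by exists y => // z Pz; apply: yP; exists z.
Qed.

End WellPreorder.

Definition lex (N : Type) (r s : N -> N -> Prop) (x y : N) : Prop :=
  r x y /\ (r y x -> s x y).

Lemma well_preorder_lex (N : Type) (r s : N -> N -> Prop) :
  well_preorder r -> well_preorder s -> well_preorder (lex r s).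
Proof.
move=> [rT rW] [sT sW]; split.
  move=> x y z [xy sxy] [yz syz]; split; first exact: rT xy yz.
  by move=> zx; apply: sT (sxy _) (syz _); [exact: rT yz zx|exact: rT zx xy].
move=> P /rW[x Px xP].
have [|y [Py yx] yP] := sW (fun y => P y /\ r y x).
  by exists x; split=> //; exact: xP.
exists y => // z Pz; split; first by apply: rT yx _; exact: xP.
by move=> zy; apply: yP; split=> //; exact: rT zy yx.
Qed.

Section Rank.
Variables (N : Type) (R : N -> N -> Prop).

(* Comparison of ordinal ranks along R, without ordinals. *)
Inductive rank_le : N -> N -> Prop :=
  RankLe x y :
    (forall x', R x' x -> exists2 y', R y' y & rank_le x' y') -> rank_le x y.

Lemma rank_leP (x y x' : N) :
  rank_le x y -> R x' x -> exists2 y', R y' y & rank_le x' y'.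
Proof. by move=> xy; case: xy x' => {}x {}y; exact. Qed.

Hypothesis R_wf : well_founded R.

Lemma rank_le_trans (x y z : N) : rank_le x y -> rank_le y z -> rank_le x z.
Proof.
elim/(well_founded_ind R_wf): x y z => x IH y z xy yz.
constructor=> x' xx'; have [y' yy' le_xy] := rank_leP xy xx'.
have [z' zz' le_yz] := rank_leP yz yy'.
by exists z' => //; exact: IH le_xy le_yz.
Qed.

(** Some predecessor [x'] of [x] ranks below no predecessor of [y]; by induction each of these ranks
    below a predecessor of [x'], so [y] ranks below [x']. *)
Lemma rank_ltP (x y : N) : ~ rank_le x y -> exists2 x', R x' x & rank_le y x'.
Proof.
elim/(well_founded_ind R_wf): x y => x IH y nle.
have [x' xx' x'P] : exists2 x', R x' x & forall y', R y' y -> ~ rank_le x' y'.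
  apply: contrapT => H; apply: nle; constructor=> x' xx'.
  apply: contrapT => H'; apply: H; exists x' => // y' yy' le_xy.
  by apply: H'; exists y'.
by exists x' => //; constructor=> y' /x'P; exact: IH.
Qed.

Lemma rank_lt_irr (x y : N) : R y x -> ~ rank_le x y.
Proof.
elim/(well_founded_ind R_wf): x y => x IH y xy le_xy.
by have [z yz le_yz] := rank_leP le_xy xy; exact: IH xy z yz le_yz.
Qed.

Lemma well_preorder_rank : well_preorder rank_le.
Proof.
split=> [|P [x Px]]; first exact: rank_le_trans.
have le_refl y : rank_le y y.
  elim/(well_founded_ind R_wf): y => y IH.
  by constructor=> z yz; exists z => //; exact: IH.
(* Induction on an upper bound [z] rather than on [y]: an element ranking lower than [y] need not
   precede it in [R], but it ranks below a predecessor of the bound. *)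
suff least z y : P y -> rank_le y z ->
    exists2 x, P x & forall y, P y -> rank_le x y by exact: least Px (le_refl x).
elim/(well_founded_ind R_wf): z y => {Px}x IH y Py le_yx.
have [yP|] := pselect (forall z, P z -> rank_le y z); first by exists y.
move=> /existsNP[z] /not_implyP[Pz /rank_ltP[y' yy' le_zy']].
have [x' xx' le_y'x'] := rank_leP le_yx yy'.
exact: IH xx' z Pz (rank_le_trans le_zy' le_y'x').
Qed.

End Rank.

(** * Lexicographic values of nodes, one component per priority *)

Section ParityGraph.
Variables (N : Type) (E : N -> N -> Prop) (pr : N -> nat) (D : nat).
Hypothesis pr_lt : forall x, pr x < D.
Hypothesis E_parity : forall xs : nat -> N,
  (forall i, E (xs i) (xs i.+1)) -> parity_seq (fun i => pr (xs i)).

(* A path through priorities at most j enters Y just after its n-th step, which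
   leaves a node of priority j. *)
Fixpoint visits (j : nat) (Y : N -> Prop) (n : nat) (x : N) : Prop :=
  match n with
  | 0 => pr x = j /\ exists2 y, E x y & Y y
  | n'.+1 => pr x <= j /\ exists2 y, E x y & visits j Y n' y
  end.

(** The later node is the smaller one, so that well-foundedness limits the visits to [j]. For even
    [j] the relation is empty and all ranks are equal. *)
Definition visit_rel (j : nat) (y x : N) : Prop :=
  odd j /\ exists n, visits j (fun z => z = y) n x.

Lemma visits_sub (j : nat) (Y Y' : N -> Prop) (n : nat) (x : N) :
  (forall y, Y y -> Y' y) -> visits j Y n x -> visits j Y' n x.
Proof.
move=> YY'; elim: n x => [|n IH] x /= [prx [y Exy Yy]]; split=> //; exists y => //.
  exact: YY'.
exact: IH.
Qed.

(** Concatenating paths between inaccessible nodes would give an infinite path through priorities at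
    most [j] on which the odd [j] recurs. *)
Lemma visit_rel_wf (j : nat) : well_founded (visit_rel j).
Proof.
move=> x0; apply: contrapT => bad0.
have [oj|ej] := boolP (odd j); last first.
  by apply: bad0; constructor=> y [oj]; rewrite oj in ej.
pose bad x := ~ Acc (visit_rel j) x.
have badP x : bad x -> exists n, visits j bad n x.
  move=> badx; apply: contrapT => nx; apply: badx; constructor=> y [_ [n nP]].
  apply: contrapT => bady; apply: nx; exists n.
  by apply: visits_sub nP => _ ->.
have [n0 n0P] := badP _ bad0.
pose I (z : nat * N) := visits j bad z.1 z.2.
pose S (z z' : nat * N) :=
  [/\ E z.2 z'.2, pr z.2 <= j & if z.1 is n.+1 then z'.1 = n else pr z.2 = j].
have [|[[|n] x]|zs [_ zsP]] := @dependent_choice _ I S (n0, x0) => //=.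
- move=> [prx [y Exy /badP[n nP]]].
  by exists (n, y) => //; split=> //=; rewrite prx.
- by move=> [prx [y Exy yP]]; exists (n, y).
have /E_parity par i : E (zs i).2 (zs i.+1).2 by have [_ []] := zsP i.
apply: (@parity_seq_odd _ j 0 par oj) => [n|i _]; last by have [_ []] := zsP i.
elim: {n}_.+1 {-2}n (ltnSn (zs n).1) => // c IH n.
have [_ [_ _]] := zsP n; case eqc: (zs n).1 => [|c'] eqn lec.
  by exists n.
have [|m nm mP] := IH n.+1; first by rewrite eqn; lia.
by exists m => //; exact: ltnW.
Qed.

(** Greater priorities are more significant: rank [k] is consulted only on ties in the components
    above it. *)
Fixpoint lex_ranks (k c : nat) : N -> N -> Prop :=
  if c is c'.+1 then lex (lex_ranks k.+1 c') (rank_le (visit_rel k))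
  else fun _ _ => True.

Definition rank_order (k : nat) : N -> N -> Prop := lex_ranks k (D - k).

Lemma well_preorder_lex_ranks (k c : nat) : well_preorder (lex_ranks k c).
Proof.
elim: c k => [|c IH] k /=; first by split=> // P [x Px]; exists x.
by apply: well_preorder_lex (IH _) (well_preorder_rank (@visit_rel_wf k)).
Qed.

Lemma lex_ranks_coarsen (k c k' : nat) (x y : N) :
  lex_ranks k (k' + c) x y -> lex_ranks (k + k') c x y.
Proof.
elim: k' k => [|k' IH] k /=; first by rewrite addn0.
by rewrite -addSnnS => -[/IH].
Qed.

(** Dropping the least significant components coarsens the order, so a node that is least for
    [rank_order 0] is least for every [k]. *)
Lemma rank_order_coarsen (k : nat) (x y : N) :
  rank_order 0 x y -> rank_order k x y.
Proof.
rewrite /rank_order subn0 => xy.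
have [kD|Dk] := leqP k D; last by rewrite (_ : D - k = 0) //; lia.
by apply: (@lex_ranks_coarsen 0 (D - k) k); rewrite subnKC.
Qed.

(** Prefixing the edge turns a path from [y] into one from [x]; in each component from [k] on,
    whatever is below [y] is thus below [x]. *)
Lemma rank_order_edge (k : nat) (x y : N) :
  E x y -> pr x <= k -> rank_order k y x.
Proof.
rewrite /rank_order => Exy; move: (D - k) => c; elim: c k => [|c IH] k //= prx.
split=> [|_]; first by apply: IH; exact: leqW.
constructor=> z [ok [n nP]]; exists z; last first.
  exact: well_preorder_refl (well_preorder_rank (@visit_rel_wf k)) _.
by split=> //; exists n.+1; split=> //; exists y.
Qed.

(** Components above [k] do not increase along the edge, and in component [k] the node [y] is itself
    a predecessor of [x], by a path of one edge. *)
Lemma rank_order_odd_edge (k : nat) (x y : N) :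
  E x y -> pr x = k -> odd k -> ~ rank_order k x y.
Proof.
move=> Exy prx ok; have := pr_lt x; have := @rank_order_edge k.+1 _ _ Exy.
rewrite /rank_order prx => edge kD.
rewrite (_ : D - k = (D - k.+1).+1) /=; last by lia.
move=> [_ /(_ (edge (leqnSn k)))].
by apply: rank_lt_irr; [exact: visit_rel_wf|split=> //; exists 0; split=> //; exists y].
Qed.

End ParityGraph.

(** * Tokens and latest appearance records *)

Fixpoint token (B : Type) (g : nat -> B -> B) (s : nat) (x : B) (c : nat) : B :=
  if c is c'.+1 then g (s + c') (token g s x c') else x.

Section Flash.
Variables (n : nat) (g : nat -> 'I_n -> 'I_n) (F : nat -> 'I_n -> Prop).
Variable r : nat -> 'I_n.
Hypothesis g_homo : forall j (x y : 'I_n), x <= y -> g j x <= g j y.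
Hypothesis g_strict : forall j (x y : 'I_n), ~ F j y -> x < y -> g j x < g j y.
Variable N : nat.
Hypothesis r_le : forall j, N <= j -> r j.+1 <= g j (r j).
Hypothesis r_event :
  recurrent (fun j => r j.+1 < g j (r j) \/ F j (r j)).

Lemma token_ge (s c : nat) : N <= s -> r (s + c) <= token g s (r s) c.
Proof.
move=> Ns; elim: c => [|c IH]; rewrite ?addn0 // addnS /=.
by apply: leq_trans (r_le _) (g_homo _ IH); lia.
Qed.

(* Among the tokens released at r, take one whose limit inferior is minimal. If
   it flashed finitely often, then a token released at r after the next event
   would stay strictly below it. *)
Lemma recurrent_flash :
  exists s x, recurrent (fun c => F (s + c) (token g s x c)).
Proof.
apply: contrapT => noflash.
pose low v :=
  exists2 s, N <= s & recurrent (fun c => token g s (r s) c <= v).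
have ex_low : exists v, `[< low v >].
  by exists n; apply/asboolP; exists N => // c; exists c => //; exact: ltnW.
case: (ex_minnP ex_low) => v /asboolP[s Ns lows] minv.
have [C nF] : exists C, forall c, C <= c -> ~ F (s + c) (token g s (r s) c).
  by apply/not_recurrent => rF; apply: noflash; exists s, (r s).
have [j Cj event] := r_event (s + C).
pose c := j - s; have jE : j = s + c by rewrite subnKC //; lia.
have nFc d : ~ F (j + d) (token g s (r s) (c + d)).
  by rewrite jE -addnA; apply: nF; rewrite /c; lia.
have below d : token g j.+1 (r j.+1) d < token g s (r s) (c.+1 + d).
  elim: d => [|d IH] /=.
    rewrite addn0 /= -jE; have := token_ge c Ns; rewrite -jE => rj.
    have := nFc 0; rewrite !addn0 => nFj.
    (* A token at [r j] itself does not flash, so the event is a strict descent of [r]; a token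
       above [r j] keeps its distance because [g] is strict below non-flashing positions. *)
    move: rj; rewrite leq_eqVlt => /orP[/eqP/val_inj rj|rj].
      by case: event; rewrite rj.
    by apply: leq_ltn_trans (g_strict nFj rj); apply: r_le; lia.
  have -> : s + (c + d.+1) = j.+1 + d by lia.
  by apply: g_strict => //; have := nFc d.+1; rewrite !addnS.
have lowP : recurrent (fun d => token g s (r s) (c.+1 + d) <= v).
  exact/(recurrent_shift (fun c => token g s (r s) c <= v)).
have v0 : 0 < v by have [d _] := lowP 0; have := below d; lia.
suff /asboolP/minv : low v.-1 by lia.
exists j.+1 => [|m]; first by lia.
by have [d md dv] := lowP m; exists d => //; have := below d; lia.
Qed.

End Flash.

(** * Latest appearance records of tokens *)

Section Appearance.
Variable B : finType.
Local Notation m := #|B|.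

(** The odd priority of a flash at rank [x], greater for older tokens. The even number just above it
    serves as the priority of a vacancy at rank [x]. *)
Definition weight (x : 'I_m) : nat := (m - x).*2.+1.

(* A latest appearance record: x b is the age rank of the token at b, the oldest
   having rank 0, and p is the priority of the step. *)
Definition record_step (x : B -> 'I_m) (g : B -> B) (F : B -> bool)
    (x' : B -> 'I_m) (p : nat) : Prop :=
  forall b, [/\ x' (g b) <= x b, F b -> weight (x b) <= p
              & ~~ odd p -> weight (x b) <= p -> x' (g b) < x b].

(** Age ranks never increase along a token, so they settle at some [v]. Infinitely many flashes
    raise the greatest recurrent priority to at least the weight of [v]; being even, it then forces
    a further decrease. *)
Lemma record_sound (x : nat -> B -> 'I_m) (g : nat -> B -> B)
    (F : nat -> B -> bool) (p : nat -> nat) (D s : nat) (b : B) :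
  (forall j, record_step (x j) (g j) (F j) (x j.+1) (p j)) ->
  (forall j, p j < D) -> parity_seq p ->
  ~ recurrent (fun c => F (s + c) (token g s b c)).
Proof.
move=> step pD [k [ek rk maxk]] rF.
pose y c : nat := x (s + c) (token g s b c).
have y_le c d : y (c + d) <= y c.
  elim: d => [|d IH]; rewrite ?addn0 // addnS; apply: leq_trans IH.
  by rewrite /y addnS; have [] := step (s + (c + d)) (token g s b (c + d)).
have [v [_ rv [C yC]]] := @recurrent_max y m (fun c => ltn_ord _).
have {}yC c : C <= c -> y c = v.
  move=> Cc; apply/eqP; rewrite eqn_leq yC //=.
  by have [d cd <-] := rv c; have := y_le c (d - c); rewrite subnKC.
have lek : (m - v).*2.+1 <= k.
  have [l [_ rl [L pL]]] := recurrent_max pD.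
  have [c Lc Fc] := rF (L + C); apply: leq_trans (maxk _ rl).
  apply: leq_trans (pL (s + c) _); last by lia.
  have [_ /(_ Fc) + _] := step (s + c) (token g s b c).
  by rewrite /weight -/(y c) yC //; lia.
have [j sCj pj] := rk (s + C).
pose c := j - s; have jE : j = s + c by rewrite subnKC //; lia.
have Cc : C <= c by rewrite /c; lia.
have [_ _] := step j (token g s b c); rewrite pj => /(_ ek).
have := yC _ Cc; have := yC _ (leqW Cc).
by rewrite /y addnS /= -jE /weight => -> ->; rewrite ltnn => /(_ lek).
Qed.

(* The key of an occupied position is the rank of its oldest token; sorting by
   keys fills the gaps left by tokens that merged into older ones. The priority is
   given by the least rank that flashes or becomes vacant. *)
Lemma record_next (x : B -> 'I_m) (g : B -> B) (F : B -> bool) :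
  injective x -> exists x' p,
    [/\ injective x', record_step x g F x' p, p < m.*2.+3,
        odd p -> exists2 b, F b & p = weight (x b)
      & forall b, p <= weight (x b) -> x' (g b) = x b].
Proof.
move=> x_inj.
(* Vacant positions get distinct keys from [m] upward, behind all occupied ones. *)
have /choice[key keyP] b' : exists k : nat,
    (exists b, [/\ g b = b', k = x b & forall c, g c = b' -> x b <= x c]) \/
    (k = m + enum_rank b' /\ forall b, g b <> b').
  have [[b bb']|nb] := pselect (exists b, g b = b').
    case: (@arg_minnP _ b (fun c => g c == b') (fun c => x c)); first exact/eqP.
    move=> c /eqP cb' minc; exists (x c); left; exists c; split=> // d /eqP.
    exact: minc.
  exists (m + enum_rank b'); right; split=> // b bb'; apply: nb; by exists b.
have key_inj : injective key.
  move=> b1 b2; have [[c1 [<- -> _]]|[-> _]] := keyP b1;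
    have [[c2 [<- -> _]]|[-> _]] := keyP b2.
  - by move/val_inj/x_inj ->.
  - by have := ltn_ord (x c1); lia.
  - by have := ltn_ord (x c2); lia.
  - by move/addnI/val_inj/enum_rank_inj.
pose cnt v := #|[pred b | key b < v]|.
have cntS v : cnt v.+1 = [exists b, key b == v] + cnt v.
  case: existsP => [[b0 /eqP b0v]|nv].
    rewrite add1n -[RHS]add1n; have := cardU1 b0 [pred b | key b < v].
    rewrite inE b0v ltnn => <-; apply: eq_card => b.
    rewrite !inE ltnS leq_eqVlt; congr (_ || _).
    by apply/eqP/eqP => [|->//]; rewrite -b0v; exact: key_inj.
  apply: eq_card => b; rewrite !inE ltnS leq_eqVlt; case: eqP => // bv.
  by case: nv; exists b; apply/eqP.
have cnt0 : cnt 0 = 0 by apply: eq_card0 => b; rewrite inE.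
have cnt_le v : cnt v <= v.
  by elim: v => [|v IH]; rewrite ?cnt0 // cntS; case: existsP => _; lia.
have cnt_lt d v : d < v -> (forall b, key b <> d) -> cnt v < v.
  elim: v => // v IH; rewrite ltnS leq_eqVlt cntS => /orP[/eqP->|dv] nd.
    case: existsP => [[b /eqP/nd//]|_]; exact: cnt_le.
  by have := IH dv nd; case: existsP => _; lia.
have cnt_eq v : (forall d, d < v -> exists b, key b = d) -> cnt v = v.
  elim: v => [|v IH] // onto; rewrite cntS IH; last by move=> d ?; apply: onto; lia.
  by case: existsP => // -[]; have [//|b <-] := onto v; exists b.
have cnt_lt_card b : cnt (key b) < m.
  have sub : cnt (key b) <= #|predC1 b|.
    apply: subset_leq_card; apply/fintype.subsetP => c; rewrite !inE.
    by apply: contraTneq => ->; rewrite ltnn.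
  by move: sub; rewrite cardC1; have := ltn_ord (x b); lia.
have cnt_key_mono b b' : key b < key b' -> cnt (key b) < cnt (key b').
  move=> bb'; apply: leq_trans (_ : cnt (key b).+1 <= _).
    by rewrite cntS; case: existsP => // -[]; exists b.
  apply: subset_leq_card; apply/fintype.subsetP => c.
  by rewrite !inE => cb; exact: leq_trans bb'.
(* As [x] is a bijection onto the ranks, a rank that is no key belonged to a token that merged into
   an older one. *)
pose dead r := r < m /\ forall b, key b <> r.
pose flash r := exists2 b, F b & x b = r :> nat.
pose x' b := Ordinal (cnt_lt_card b).
have x'_inj : injective x'.
  move=> b b' /(congr1 val) /= eqc; apply: key_inj.
  by case: (ltngtP (key b) (key b')) => // /cnt_key_mono; rewrite eqc ltnn.
have key_le b : key (g b) <= x b.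
  have [[c [_ -> minc]]|[_ /(_ b)//]] := keyP (g b); exact: minc.
have x'_le b : x' (g b) <= x b by apply: leq_trans (cnt_le _) (key_le b).
have x'_lt b r : dead r -> r <= x b -> x' (g b) < x b.
  move=> [_ nr] rb /=; have := key_le b; rewrite leq_eqVlt => /orP[/eqP kb|].
    rewrite kb; apply: (@cnt_lt r) => //; rewrite ltn_neqAle rb andbT.
    by apply/eqP => rE; apply: (nr (g b)); rewrite kb.
  by move=> kb; exact: leq_ltn_trans (cnt_le _) kb.
have x'_eq b : (forall r, r <= x b -> ~ dead r) -> x' (g b) = x b.
  move=> nd; have onto r : r <= x b -> exists b', key b' = r.
    move=> rb; apply: contrapT => nr; apply: (nd _ rb); split.
      by have := ltn_ord (x b); lia.
    by move=> b' b'r; apply: nr; exists b'.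
  have [b' b'x] := onto _ (leqnn _).
  have gb : g b = b'.
    have [[c [gc ck _]]|[ck _]] := keyP b'.
      by rewrite -gc; congr g; apply/x_inj/val_inj; rewrite /= -b'x ck.
    by have := ltn_ord (x b); lia.
  by apply: val_inj; rewrite /= gb b'x cnt_eq // => d /ltnW; exact: onto.
have [none|some] := pselect (forall r, ~ (dead r \/ flash r)).
  exists x', 0; split=> // b; last first.
    by move=> _; apply: x'_eq => r _ dr; apply: (none r); left.
  split=> // Fb; by case: (none (x b)); right; exists b.
have ex_ev : exists r, `[< dead r \/ flash r >].
  by move: some => /existsNP[r /contrapT ?]; exists r; apply/asboolP.
case: (ex_minnP ex_ev) => r /asboolP r_ev minr.
have rm : r < m by case: r_ev => [[]//|[b _ <-]].
have r_dead s : dead s -> r <= s by move=> ds; apply: minr; apply/asboolP; left.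
have r_flash b : F b -> r <= x b.
  by move=> Fb; apply: minr; apply/asboolP; right; exists b.
(* A vacancy prevails over a flash of the same rank: the flashing token has merged into an older
   one, so its rank decreases. *)
have [dr|ndr] := pselect (dead r).
  exists x', (m - r).*2.+2; split=> //; last 2 first.
  - by rewrite /= odd_double.
  - move=> b; rewrite /weight => prb; apply: x'_eq => s sb ds.
    by have := r_dead _ ds; lia.
  - move=> b; rewrite /weight; split=> // [/r_flash|_ prb]; first by lia.
    by apply: x'_lt dr _; have := ltn_ord (x b); lia.
  - by lia.
have [b Fb xb] : flash r by case: r_ev.
exists x', (m - r).*2.+1; split=> //.
- move=> c; split=> // [/r_flash|]; first by rewrite /weight; lia.
  by rewrite /= odd_double.
- by lia.
- by exists b; rewrite ?/weight ?xb.
- move=> c; rewrite /weight => prc; apply: x'_eq => s sc ds.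
  have := r_dead _ ds; rewrite leq_eqVlt => /orP[/eqP rs|]; last by lia.
  by apply: ndr; rewrite rs.
Qed.

(** If an odd [k] were the greatest recurrent priority, a token flashing with weight [k] late enough
    would keep its rank forever. By injectivity, all later flashes of weight [k] would be its
    own. *)
Lemma record_complete (x : nat -> B -> 'I_m) (g : nat -> B -> B)
    (F : nat -> B -> bool) (p : nat -> nat) :
  (forall j, injective (x j)) -> (forall j, p j < m.*2.+3) ->
  (forall j, odd (p j) -> exists2 b, F j b & p j = weight (x j b)) ->
  (forall j b, p j <= weight (x j b) -> x j.+1 (g j b) = x j b) ->
  (forall s b, ~ recurrent (fun c => F (s + c) (token g s b c))) ->
  parity_seq p.
Proof.
move=> x_inj p_lt p_odd p_keep nF; apply: (parity_seqP p_lt) => k N ok rk pk.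
have [s Ns ps] := rk N.
have [|b _ psb] := p_odd s; first by rewrite ps.
rewrite ps in psb.
have xE c : x (s + c) (token g s b c) = x s b.
  elim: c => [|c IH]; rewrite ?addn0 // addnS /= p_keep //.
  by rewrite IH -psb; apply: pk; lia.
apply: (nF s b) => n; have [j nj pj] := rk (s + n).
have [|b' Fb' pb'] := p_odd j; first by rewrite pj.
exists (j - s); first by lia.
have jE : s + (j - s) = j by lia.
suff -> : token g s b (j - s) = b' by rewrite jE.
apply: (x_inj j); rewrite -{1}jE xE; apply: val_inj.
have := ltn_ord (x s b); have := ltn_ord (x j b').
by move: pb'; rewrite pj psb /weight /=; lia.
Qed.

End Appearance.

(** * One-step formulas *)

Section Connectives.
Variables (T : set_functor) (Lam : lifting_set T) (var : eqType).
Implicit Types (f : formula Lam var) (v : var).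

Definition FAnd f g := FNeg (FOr (FNeg f) (FNeg g)).
Definition FImp f g := FOr (FNeg f) g.
Definition FAll v f := FNeg (FEx v (FNeg f)).
Definition FTop v : formula Lam var := FAll v (FSub _ v v).
Definition FWhen v (b : bool) f := if b then f else FTop v.
Definition FConj v (I : Type) (s : seq I) (f : I -> formula Lam var) :=
  foldr (fun i => FAnd (f i)) (FTop v) s.
Definition FExs (s : seq var) f := foldr (@FEx _ _ _) f s.

Section Satisfaction.
Variables (X : Sets) (alpha : T X).
Implicit Type V : var -> set X.

Lemma sat_and V f g : sat alpha V (FAnd f g) <-> sat alpha V f /\ sat alpha V g.
Proof.
split=> [/= nfg|[Vf Vg] []//].
by split; apply: contrapT => ?; apply: nfg; [left|right].
Qed.

Lemma sat_imp V f g : sat alpha V (FImp f g) <-> (sat alpha V f -> sat alpha V g).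
Proof.
split=> [[nf /nf|Vg] //|fg] /=.
by have [/fg|] := pselect (sat alpha V f); [right|left].
Qed.

Lemma sat_all V v f :
  sat alpha V (FAll v f) <-> forall Y, sat alpha (update V v Y) f.
Proof.
split=> [nf Y|Vf [Y nY]]; last exact: nY (Vf Y).
by apply: contrapT => nfY; apply: nf; exists Y.
Qed.

Lemma sat_top V v : sat alpha V (FTop v).
Proof. by apply/sat_all => Y /=. Qed.

Lemma sat_when V v b f : sat alpha V (FWhen v b f) <-> (b -> sat alpha V f).
Proof.
by case: b; split=> //= Vf; [exact: Vf|exact: sat_top].
Qed.

Lemma sat_conj V v (I : eqType) (s : seq I) (f : I -> formula Lam var) :
  sat alpha V (FConj v s f) <-> forall i, i \in s -> sat alpha V (f i).
Proof.
elim: s => [|i s IH]; first by split=> // _; exact: sat_top.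
split=> [/sat_and[Vi /IH Vs] j|Vis].
  by rewrite inE => /orP[/eqP->//|/Vs].
apply/sat_and; split; first by apply: Vis; exact: mem_head.
by apply/IH => j js; apply: Vis; rewrite inE js orbT.
Qed.

Lemma sat_exs V (s : seq var) f :
  sat alpha V (FExs s f) <->
  exists2 V', (forall v, v \notin s -> V' v = V v) & sat alpha V' f.
Proof.
elim: s V => [|v s IH] V /=; split.
- by exists V.
- by move=> [V' V'V]; rewrite (_ : V' = V) //; apply/funext => v; exact: V'V.
- move=> [Y /IH[V' V'P V'f]]; exists V' => // u.
  by rewrite inE negb_or => /andP[/negPf uv /V'P->]; rewrite /update uv.
move=> [V' V'P V'f]; exists (V' v); apply/IH; exists V' => // u us.
by rewrite /update; case: eqP => [->//|/eqP uv]; apply: V'P; rewrite inE negb_or uv.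
Qed.

Lemma sat_free V V' f :
  (forall v, free f v -> V v = V' v) -> sat alpha V f <-> sat alpha V' f.
Proof.
elim: f V V' => [a b|l a|f IH|f IHf g IHg|a f IH] V V' VV' /=.
- by rewrite !VV' /=; [|right|left].
- rewrite (_ : (fun i => V (a i)) = (fun i => V' (a i))) //.
  by apply: funext => i; apply: VV'; exists i.
- by have [fw bw] := IH V V' VV'; split=> nf ?; apply: nf; [exact: bw|exact: fw].
- have [fw bw] := IHf V V' (fun v fv => VV' v (or_introl fv)).
  have [gw hw] := IHg V V' (fun v gv => VV' v (or_intror gv)).
  by split=> -[?|?]; [left; exact: fw|right; exact: gw|left; exact: bw|right; exact: hw].
have eqf Y : sat alpha (update V a Y) f <-> sat alpha (update V' a Y) f.
  apply: IH => v fv; rewrite /update; case: eqP => // va.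
  by apply: VV'; split.
by split=> -[Y /eqf ?]; exists Y.
Qed.

End Satisfaction.

Lemma free_and f g (D : set var) :
  free f `<=` D -> free g `<=` D -> free (FAnd f g) `<=` D.
Proof. by move=> fD gD v /= [/fD|/gD]. Qed.

Lemma free_conj v (I : Type) (s : seq I) (f : I -> formula Lam var)
    (D : set var) :
  (forall i, free (f i) `<=` D) -> free (FConj v s f) `<=` D.
Proof.
move=> fD; elim: s => [|i s IH] u /=.
  by move=> [[->|->] nv]; case: nv.
by move=> [/fD|/IH].
Qed.

Lemma free_when v b f (D : set var) :
  free f `<=` D -> free (FWhen v b f) `<=` D.
Proof. by case: b => // _ u /= [[->|->] nv]; case: nv. Qed.

Lemma free_exs (s : seq var) f (D : set var) :
  free f `<=` D `|` [set v | v \in s] -> free (FExs s f) `<=` D.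
Proof.
elim: s D => [|v s IH] D /= fD u.
  by move=> /fD[].
move=> [fu uv]; suff: (D `|` [set v]) u by case.
apply: IH fu => w /fD[|]; [by left; left|]. 
by rewrite /= inE => /orP[/eqP->|]; [left; right|right].
Qed.

End Connectives.

Section Rename.
Variables (T : set_functor) (Lam : lifting_set T) (var var' : eqType).
Variable h : var -> var'.

Fixpoint rename (f : formula Lam var) : formula Lam var' :=
  match f with
  | FSub a b => FSub _ (h a) (h b)
  | FLift _ a => FLift (h \o a)
  | FNeg g => FNeg (rename g)
  | FOr f g => FOr (rename f) (rename g)
  | FEx a g => FEx (h a) (rename g)
  end.

Lemma sat_rename (X : Sets) (alpha : T X) (V : var' -> set X) f :
  injective h -> sat alpha V (rename f) <-> sat alpha (V \o h) f.
Proof.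
move=> h_inj; elim: f V => [a b|l a|f IH|f IHf g IHg|a f IH] V //=.
- by split=> nf /IH.
- by split=> -[/IHf|/IHg]; [left|right|left|right].
have upd Y : update V (h a) Y \o h = update (V \o h) a Y.
  by apply: funext => b; rewrite /update /= (inj_eq h_inj).
by split=> -[Y]; [move=> /IH|move=> Yf]; exists Y; [rewrite -upd|apply/IH; rewrite upd].
Qed.

Lemma free_rename f : free (rename f) `<=` h @` free f.
Proof.
elim: f => [a b|l a|f IH|f IHf g IHg|a f IH] v /=.
- by move=> [->|->]; [exists a; [left|]|exists b; [right|]].
- by move=> [i _ <-]; exists (a i) => //; exists i.
- exact: IH.
- by move=> [/IHf|/IHg] [u fu <-]; exists u => //; [left|right].
by move=> [/IH[u fu <-] hua]; exists u => //; split=> // ua; apply: hua; rewrite /= ua.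
Qed.

End Rename.

(** Shift a copy of the natural numbers inside [Aux] by the size of [C] and fix all other elements.
    This makes room for fresh bound variables. *)
Lemma infinite_hotel (Aux : eqType) (C : finType) :
  infinite_set [set: Aux] -> exists h : C + Aux -> Aux, injective h.
Proof.
move=> /infiniteP/card_leP[e0].
pose e (i : nat) : Aux := val (e0 (SigSub (mem_set (I : [set: nat] i)))).
have e_inj : injective e.
  by move=> i j /val_inj/(@inj _ _ _ e0) - /(_ (mem_set I) (mem_set I)) [].
pose h (x : C + Aux) : Aux :=
  match x with
  | inl c => e (enum_rank c)
  | inr a => if pselect (exists i, e i = a) is left P then e (sval (cid P) + #|C|)
             else a
  end.
exists h => -[c|a] [d|b] /=.
- by move=> /e_inj/val_inj/enum_rank_inj ->.
- case: pselect => [P /e_inj cP|nP eb].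
    by have := ltn_ord (enum_rank c); rewrite cP ltnNge leq_addl.
  by case: nP; exists (enum_rank c).
- case: pselect => [P /e_inj dP|nP eb].
    by have := ltn_ord (enum_rank d); rewrite -dP ltnNge leq_addl.
  by case: nP; exists (enum_rank d).
case: pselect => [P|nP]; case: pselect => [Q|nQ].
- move=> /e_inj/addIn ePQ.
  by have := svalP (cid P); have := svalP (cid Q); rewrite ePQ => -> ->.
- by move=> eb; case: nQ; exists (sval (cid P) + #|C|).
- by move=> ea; case: nP; exists (sval (cid Q) + #|C|).
by move->.
Qed.

(** * Transition formulas of the simulating automaton *)

Section Simulation.
Variables (T : set_functor) (Lam : lifting_set T) (Aux : eqType).
Hypothesis Aux_infinite : infinite_set [set: Aux].
Variables (A B : finType) (active : pred A) (succ : pred B) (edge : B -> rel A).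
Variable d : A -> so1 Lam Aux A.

(** The states in [A] become bound auxiliary variables: [U] is quantified existentially inside the
    formula, and only variables from [B] stay free. *)
Lemma simulation_formula : exists f : so1 Lam Aux B,
  forall (X : Sets) (alpha : T X) (V : B -> set X), sat1 alpha V f <->
    [/\ forall u v, u <> v -> V u `&` V v = set0,
        forall u x, V u x -> succ u
      & forall a, active a -> exists2 U : A -> set X, sat1 alpha U (d a) &
          forall b x, U b x -> exists2 u, edge u a b & V u x].
Proof.
have [h0 h0_inj] := @infinite_hotel Aux (A + bool)%type Aux_infinite.
pose var' := (B + Aux)%type.
pose h (x : A + Aux) : var' :=
  inr (h0 (match x with inl a => inl (inl a) | inr y => inr y end)).
have h_inj : injective h by move=> [a|x] [b|x'] [/h0_inj] // [->].
pose y : var' := inr (h0 (inl (inr true))).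
pose z : var' := inr (h0 (inl (inr false))).
have yz : y != z by apply/eqP => -[/h0_inj].
have hy b : h (inl b) != y by apply/eqP => -[/h0_inj].
pose sub (u v : var') : formula Lam var' := FSub Lam u v.
pose emp u := FAll z (sub u z).
pose disj u v := FAll y (FImp (sub y u) (FImp (sub y v) (emp y))).
(* Inclusion in a union, expressed without unions: every set [y] that contains all [u] with
   [edge u a b] contains [b]. *)
pose below a b :=
  FAll y (FImp (FConj z (enum B) (fun u => FWhen z (edge u a b) (sub (inl u) y)))
    (sub (h (inl b)) y)).
pose f1 := FConj z (enum {: B * B}) (fun uv : B * B =>
  FWhen z (uv.1 != uv.2) (disj (inl uv.1) (inl uv.2))).
pose f2 := FConj z (enum B) (fun u => FWhen z (~~ succ u) (emp (inl u))).
pose f3 := FConj z (enum A) (fun a => FWhen z (active a)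
  (FExs [seq h (inl b) | b <- enum A]
    (FAnd (FConj z (enum A) (below a)) (rename h (d a))))).
have free_f : free (FAnd f1 (FAnd f2 f3)) `<=` range inl.
  apply: free_and; last apply: free_and.
  - apply: free_conj => -[u1 u2]; apply: free_when => v /=.
    move=> [[[->|->]|[[->|->]|[[->|->] nz]]] ny] //; try by case: ny.
    + by exists u1.
    + by exists u2.
  - apply: free_conj => u; apply: free_when => v /= [[->|->] nz]; last by case: nz.
    by exists u.
  apply: free_conj => a; apply: free_when; apply: free_exs; apply: free_and.
    apply: free_conj => b v /= [[conj_v|[->|->]] ny]; last by case: ny.
      have : (range inl `|` [set y]) v.
        apply: free_conj conj_v => u; apply: free_when => {}v {ny} /= [->|->]; last by right.
        by left; exists u.
      by move=> [|/ny]//; left.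
    by right; apply: map_f; exact: mem_enum.
  by move=> v /free_rename[x /so1_free[b _ <-] <-]; right; apply: map_f; exact: mem_enum.
exists (SO1 free_f) => X alpha V.
have subP W u v : sat alpha W (sub u v) <-> W u `<=` W v by [].
have empP W u : u != z -> sat alpha W (emp u) <-> forall x, ~ W u x.
  move=> /negPf uz; rewrite sat_all; split=> [WY x Wux|Wu Y].
    by have := WY set0; rewrite subP /update eqxx uz => /(_ _ Wux).
  by rewrite subP /update eqxx uz => x /Wu.
have disjP W u v : u != y -> v != y ->
    sat alpha W (disj u v) <-> W u `&` W v = set0.
  move=> /negPf uy /negPf vy; rewrite sat_all; split=> [WY|Wuv Y].
    rewrite -subset0 => x Wx; have := WY (W u `&` W v).
    rewrite !sat_imp !subP empP // /update eqxx uy vy.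
    by move=> /(_ (@subIsetl _ _ _) (@subIsetr _ _ _) x).
  rewrite !sat_imp !subP empP // /update eqxx uy vy => Yu Yv x Yx.
  by have : (W u `&` W v) x by [split; [exact: Yu|exact: Yv]]; rewrite Wuv.
have belowP W a b : sat alpha W (below a b) <->
    forall x, W (h (inl b)) x -> exists2 u, edge u a b & W (inl u) x.
  have hyb := negPf (hy b); rewrite sat_all; split=> [WY x Wx|Wx Y].
    have := WY [set x | exists2 u, edge u a b & W (inl u) x].
    rewrite sat_imp sat_conj subP /update eqxx hyb; apply=> // u _.
    by rewrite sat_when => uab; rewrite subP /= eqxx => x' Wx'; exists u.
  rewrite sat_imp sat_conj subP /update eqxx hyb => WY x /Wx[u uab].
  by have := WY u; rewrite mem_enum sat_when => /(_ isT uab); rewrite subP /= eqxx; apply.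
have satE : sat alpha (extend V) (FAnd f1 (FAnd f2 f3)) <->
    [/\ sat alpha (extend V) f1, sat alpha (extend V) f2 & sat alpha (extend V) f3].
  by rewrite !sat_and; split=> [[? []]|[]].
have f1P : sat alpha (extend V) f1 <-> forall u v, u <> v -> V u `&` V v = set0.
  rewrite sat_conj; split=> [Vf u v uv|Vuv [u v] _].
    have := Vf (u, v); rewrite mem_enum sat_when => /(_ isT).
    by rewrite disjP //=; apply; apply/eqP.
  by rewrite sat_when disjP //= => /eqP; exact: Vuv.
have f2P : sat alpha (extend V) f2 <-> forall u x, V u x -> succ u.
  rewrite sat_conj; split=> [Vf u x Vux|Vs u _].
    have := Vf u; rewrite mem_enum sat_when empP // => /(_ isT) nV.
    by apply: contraT => /nV/(_ x).
  by rewrite sat_when empP // => /negP ns x /Vs.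
have f3P : sat alpha (extend V) f3 <->
    forall a, active a -> exists2 U : A -> set X, sat1 alpha U (d a) &
          forall b x, U b x -> exists2 u, edge u a b & V u x.
  rewrite sat_conj; split=> [Vf a aa|Va a _].
    have := Vf a; rewrite mem_enum sat_when => /(_ isT aa) /sat_exs[W WV].
    rewrite sat_and sat_conj sat_rename // => -[Wb Wd].
    exists (fun b => W (h (inl b))).
      have /(sat_free alpha)[fw _] : forall v, free (d a) v ->
        (W \o h) v = extend (fun b => W (h (inl b))) v by move=> v /so1_free[b _ <-].
      exact: fw.
    move=> b x Wx; have := Wb b; rewrite mem_enum belowP => /(_ isT _ Wx)[u uab].
    by rewrite WV; [exists u|apply/mapP => -[]].
  rewrite sat_when => /Va[U Ud UV]; apply/sat_exs.
  pose W (v : var') :=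
    if [pick b | h (inl b) == v] is Some b then U b else extend V v.
  have Wh b : W (h (inl b)) = U b.
    rewrite /W; case: pickP => [c /eqP/h_inj[->]//|/(_ b)]; by rewrite eqxx.
  exists W => [v nv|].
    rewrite /W; case: pickP => // b /eqP bv; case/negP: nv; rewrite -bv.
    by apply/mapP; exists b => //; exact: mem_enum.
  rewrite sat_and sat_conj sat_rename //; split=> [b _|].
    rewrite belowP Wh => x /UV[u uab Vux]; exists u => //.
    by rewrite /W; case: pickP.
  have /(sat_free alpha)[fw _] : forall v, free (d a) v -> extend U v = (W \o h) v.
    by move=> v /so1_free[b _ <-] /=; rewrite Wh.
  exact: fw.
by apply: (iff_trans satE); rewrite -(propext f1P) -(propext f2P) -(propext f3P).
Qed.
End Simulation.

(** * Acceptance by trees of matches *)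

Section Guided.
Variables (G : parity_game) (f : strategy G) (p : position G).

Lemma eq_guided (rho rho' : nat -> position G) (n : nat) :
  (forall k, k <= n -> rho k = rho' k) -> guided f p rho n -> guided f p rho' n.
Proof.
move=> eqr [rho0 rhoS]; split=> [|i ltin]; first by rewrite -eqr.
have [mv fE] := rhoS i ltin; rewrite -!eqr //; last exact: ltnW.
split=> // /fE ->; congr f; apply/eq_in_map => j; rewrite mem_iota => /andP[_ ji].
by apply: eqr; lia.
Qed.

Lemma guided_rcons (h : seq (position G)) (q : position G) :
  0 < size h -> guided f p (nth p h) (size h).-1 -> moves (last p h) q ->
  (eloise (last p h) -> q = f h) -> guided f p (nth p (rcons h q)) (size h).
Proof.
move=> h0 guid mvq fq.
have nthE k : k < size h -> nth p h k = nth p (rcons h q) k.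
  by move=> kh; rewrite nth_rcons kh.
have [g0 gS] : guided f p (nth p (rcons h q)) (size h).-1.
  by apply: eq_guided guid => k kh; apply: nthE; lia.
split=> // i ih; have [ih'|ih'] := ltnP i (size h).-1; first exact: gS.
have iE : i.+1 = size h by lia.
have lastE : nth p (rcons h q) i = last p h.
  by rewrite -nthE // -nth_last -iE.
have mkE : mkseq (nth p (rcons h q)) i.+1 = h.
  rewrite -[RHS](mkseq_nth p) -iE; apply/eq_in_map => j.
  by rewrite mem_iota => /andP[_ ji]; rewrite -nthE //; lia.
by rewrite lastE mkE iE nth_rcons ltnn eqxx.
Qed.

End Guided.

(** * Winning strategies and runs *)

Section Runs.
Variables (T : set_functor) (Lam : lifting_set T) (Aux : eqType) (Var : Type).
Variables (P : set Var) (AA : automaton Lam Aux P) (M : tree_model T Var).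

(* Nodes of Z represent matches at a position of eloise, and S passes to the
   matches that are one round longer. *)
Definition is_run (Z : Type) (pos : Z -> state AA * carrier M) (I : Z -> Prop)
    (S : Z -> Z -> Prop) (z0 : Z) : Prop :=
  [/\ I z0, pos z0 = (init AA, tree_root M),
      forall z, I z -> exists2 U : state AA -> set (succ (pos z).2),
        sat1 (restr (succ_supports (pos z).2)) U
          (delta (pos z).1 (colour (pos z).2)) &
        forall b t, U b t -> exists z', [/\ I z', S z z' & pos z' = (b, val t)]
    & forall zs : nat -> Z, (forall i, I (zs i) /\ S (zs i) (zs i.+1)) ->
        parity_seq (fun i => Omega (pos (zs i)).1)].

Lemma Omega_bound : exists D, forall a : state AA, Omega a < D.
Proof. by exists (\max_(a : state AA) Omega a).+1 => a; rewrite ltnS; exact: leq_bigmax. Qed.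

Local Notation G := (acceptance_game AA M).
Local Notation p0 := (inl (init AA, tree_root M) : position G).

(** The strategy recomputes the current node of [Z] from the history and plays the valuation [U]
    chosen at that node. *)
Lemma run_accepts Z pos I S z0 : @is_run Z pos I S z0 -> accepts AA M.
Proof.
move=> [I0 pos0 UP par].
have /choice[mv mvP] z : exists q : position G, I z ->
    [/\ moves (inl (pos z) : position G) q, ~~ eloise q, priority q = 0
      & forall y, moves q y ->
          exists z', [/\ I z', S z z' & y = inl (pos z')]].
  have [Iz|nI] := pselect (I z); last by exists p0.
  have [U satU UI] := UP z Iz.
  exists (inr (existT _ (pos z).2 U)) => _.
  split=> //; first by case: (pos z) U satU {UI} => a s /= U satU; exists U.
  by move=> y /= [b [t [/UI[z' [Iz' Szz' <-]] ->]]]; exists z'.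
have /choice[nx nxP] (zy : Z * position G) : exists z', I zy.1 ->
    moves (mv zy.1) zy.2 -> [/\ I z', S zy.1 z' & zy.2 = inl (pos z')].
  have [Iz|nI] := pselect (I zy.1); last by exists z0.
  have [mvy|nmv] := pselect (moves (mv zy.1) zy.2); last by exists z0.
  by have [_ _ _ /(_ _ mvy)[z']] := mvP _ Iz; exists z'.
pose upd z y := if @eloise G y then nx (z, y) else z.
pose mem (h : seq (position G)) := foldl upd z0 (behead h).
have memS rho i : mem (mkseq rho i.+2) = upd (mem (mkseq rho i.+1)) (rho i.+1).
  have E j : behead (mkseq rho j.+1) = mkseq (rho \o succn) j.
    by rewrite /mkseq /= (iotaDl 1 0) -map_comp.
  by rewrite /mem !E mkseqS foldl_rcons.
pose f h := mv (mem h).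
pose zs rho i := mem (mkseq rho i.+1).
have inv rho n : guided f p0 rho n -> forall i, i <= n ->
    [/\ I (zs rho i),
        rho i = if odd i then mv (zs rho i) else inl (pos (zs rho i))
      & i < n -> if odd i then S (zs rho i) (zs rho i.+1)
                 else zs rho i.+1 = zs rho i].
  move=> [rho0 rhoS].
  have next i : i < n -> I (zs rho i) ->
      rho i = (if odd i then mv (zs rho i) else inl (pos (zs rho i))) ->
      [/\ I (zs rho i.+1), rho i.+1 =
          if odd i.+1 then mv (zs rho i.+1) else inl (pos (zs rho i.+1))
        & if odd i then S (zs rho i) (zs rho i.+1)
          else zs rho i.+1 = zs rho i].
    move=> ltin Ii rhoi; have [mvi fE] := rhoS i ltin.
    rewrite /zs memS -/(zs rho i) /=.
    have [mv1 mv2 _ _] := mvP _ Ii.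
    move: rhoi; case: (odd i) => rhoi /=.
      rewrite rhoi in mvi; have := nxP (zs rho i, rho i.+1) Ii mvi.
      move=> [I' S' /= E']; have el : @eloise G (rho i.+1) by rewrite E'.
      by rewrite /upd el.
    have rhoS' : rho i.+1 = mv (zs rho i) by apply: fE; rewrite rhoi.
    by rewrite /upd rhoS' (negPf mv2).
  elim=> [_|i IH ltin].
    have I0' : I (zs rho 0) by [].
    have E0 : rho 0 = inl (pos (zs rho 0)) by rewrite rho0 -pos0.
    by split=> // n0; have [] := next 0 n0 I0' E0.
  have [Ii Ei _] := IH (ltnW ltin); have [Ii' Ei' _] := next i ltin Ii Ei.
  by split=> // ltin'; have [] := next _ ltin' Ii' Ei'.
exists f; split=> [rho n guid el|rho guid].
  have [In En _] := inv rho n guid n (leqnn n).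
  have [mv1 mv2 _ _] := mvP _ In.
  by rewrite /f -/(zs rho n) En; move: En el; case: (odd n) => // ->; rewrite (negPf mv2).
have inv' i : [/\ I (zs rho i),
        rho i = if odd i then mv (zs rho i) else inl (pos (zs rho i))
      & if odd i then S (zs rho i) (zs rho i.+1)
                 else zs rho i.+1 = zs rho i].
  by have [? ? H] := inv rho i.+1 (guid _) i (leqnSn i); split=> //; exact: H.
have [D OD] := Omega_bound.
have parz : parity_seq (fun i => Omega (pos (zs rho i.*2)).1).
  apply: par => i; have [Ii _] := inv' i.*2; rewrite odd_double => E.
  split=> //; have [_ _] := inv' i.*2.+1; by rewrite /= odd_double /= E -doubleS.
suff [_ bw] : parity_seq (fun i => priority (rho i)) <->
    parity_seq (fun i => Omega (pos (zs rho i.*2)).1) by exact: bw parz.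
apply: (@parity_seq_interleave _ _ D) => [i|i|i //].
  by have [_ -> _] := inv' i.*2; rewrite odd_double /=; case: (pos _).
have [Ii ->] := inv' i.*2.+1; rewrite /= odd_double /= => _.
by have [] := mvP _ Ii.
Qed.

(** Nodes are the guided partial matches ending at a position of [eloise]; a step appends her answer
    and a reply [q]. *)
Lemma accepts_run : accepts AA M -> exists Z pos I S z0, @is_run Z pos I S z0.
Proof.
move=> [f [f_move f_won]].
pose pos (h : seq (position G)) :=
  if last p0 h is inl x then x else (init AA, tree_root M).
pose I h := [/\ 0 < size h, guided f p0 (nth p0 h) (size h).-1
  & eloise (last p0 h)].
pose S h h' := exists q, h' = rcons (rcons h (f h)) q.
have posP h : I h -> last p0 h = inl (pos h).
  by move=> [_ _]; rewrite /pos; case: (last p0 h).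
have fP h : I h -> moves (last p0 h) (f h).
  move=> [h0 guid el]; have := f_move _ _ guid; rewrite nth_last prednK //.
  by rewrite mkseq_nth; exact.
exists (seq (position G)), pos, I, S, [:: p0]; split=> //.
  move=> h Ih; have := fP h Ih; have := posP h Ih; rewrite /pos.
  move: Ih => [h0 guid el].
  case E: (last p0 h) el => [[a s]|//] _ _ [U satU fE].
  exists U => // b t Ubt; exists (rcons (rcons h (f h)) (inl (b, val t))).
  split; [|by exists (inl (b, val t))|by rewrite last_rcons].
  rewrite /I !size_rcons last_rcons; split=> //.
  have := @guided_rcons G f p0 (rcons h (f h)) (inl (b, val t)).
  rewrite !size_rcons last_rcons; apply=> //; last by rewrite fE.
    by apply: guided_rcons => //; rewrite E fE /=; exists U.
  by rewrite fE /=; exists b, t.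
move=> zs zsP; have Ii i := (zsP i).1.
have zsS i : exists q, zs i.+1 = rcons (rcons (zs i) (f (zs i))) q := (zsP i).2.
have sizeS i : size (zs i) = size (zs 0) + i.*2.
  elim: i => [|i IH]; first by rewrite addn0.
  by have [q ->] := zsS i; rewrite !size_rcons IH; lia.
have size0 : 0 < size (zs 0) by have [] := Ii 0.
have nthD i d k : k < size (zs i) -> nth p0 (zs (i + d)) k = nth p0 (zs i) k.
  move=> ki; elim: d => [|d IH]; rewrite ?addn0 // addnS.
  have kd : k < size (zs (i + d)) by move: ki; rewrite (sizeS i) (sizeS (i + d)); lia.
  by have [q ->] := zsS (i + d); rewrite -IH !nth_rcons size_rcons kd leqW.
pose rho k := nth p0 (zs k) k.
have rhoE j k : k < size (zs j) -> nth p0 (zs j) k = rho k.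
  move=> kj; have [jk|kj'] := leqP j k.
    by have := nthD j (k - j) k kj; rewrite subnKC.
  have kk : k < size (zs k) by rewrite (sizeS k); lia.
  by have := nthD k (j - k) k kk; rewrite subnKC // ltnW.
have /f_won par n : guided f p0 rho n.
  have [_ [g0 gS] _] := Ii n; have sn := sizeS n.
  apply: (@eq_guided _ _ _ (nth p0 (zs n))) => [k kn|]; first by apply: rhoE; lia.
  by split=> // i ltin; apply: gS; lia.
have [D OD] := Omega_bound.
(* A branch may start at any node, so the priorities before the end of [zs 0] are cut off. *)
pose p i := priority (rho ((size (zs 0)).-1 + i)).
have parp : parity_seq p.
  exact/(parity_seq_shift (fun i => priority (rho i)) (size (zs 0)).-1).
suff [fw _] : parity_seq p <->
    parity_seq (fun i => Omega (pos (zs i)).1) by exact: fw parp.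
apply: (@parity_seq_interleave _ _ D) => [i|i|i //]; rewrite /p.
  have -> : (size (zs 0)).-1 + i.*2 = (size (zs i)).-1 by rewrite (sizeS i); lia.
  rewrite -(rhoE i); last by rewrite (sizeS i); lia.
  by rewrite nth_last posP //=; case: (pos _).
have -> : (size (zs 0)).-1 + i.*2.+1 = size (zs i) by rewrite (sizeS i); lia.
rewrite -(rhoE i.+1); last by rewrite (sizeS i) (sizeS i.+1); lia.
have [q ->] := zsS i; rewrite !nth_rcons size_rcons ltnSn ltnn eqxx.
have := fP _ (Ii i); rewrite posP //; case: (pos _) => a s [U _ ->].
by [].
Qed.

End Runs.

(** * The simulating automaton *)

Section Measure.
Variables (T : set_functor) (Lam : lifting_set T) (Aux : eqType) (Var : Type).
Variables (P : set Var) (AA : automaton Lam Aux P) (M : tree_model T Var).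
Local Notation A := (state AA).
Local Notation S := (carrier M).

(* A positional winning strategy U on the alive positions, witnessed by
   preorders along which plays descend. That only the initial state is alive at
   the root makes the ranks of the alive states there independent of M. *)
Definition progress_measure (alive : A -> S -> Prop)
    (U : A -> forall s : S, A -> set (succ s))
    (le : nat -> A * S -> A * S -> Prop) : Prop :=
  [/\ forall k, well_preorder (le k), alive (init AA) (tree_root M),
      forall a, alive a (tree_root M) -> a = init AA
    & forall a s, alive a s ->
        sat1 (restr (succ_supports s)) (U a s) (delta a (colour s)) /\
        forall b t, U a s b t ->
          [/\ alive b (val t),
              forall k, Omega a <= k -> le k (b, val t) (a, s)
            & odd (Omega a) -> ~ le (Omega a) (a, s) (b, val t)]].

(* The value of a position is the least value of a match ending there, and the
   strategy moves as in such a match. *)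
Lemma accepts_measure :
  accepts AA M -> exists alive U le, progress_measure alive U le.
Proof.
move=> /accepts_run[Z [pos [I [Sz [z0 [I0 pos0 UP par]]]]]].
pose E z z' := [/\ I z, I z' & Sz z z'].
pose pr z := Omega (pos z).1.
have [D OD] := Omega_bound AA.
have prD z : pr z < D by exact: OD.
have Epar zs : (forall i, E (zs i) (zs i.+1)) -> parity_seq (fun i => pr (zs i)).
  by move=> Ezs; apply: par => i; have [] := Ezs i.
pose ord := rank_order E pr D.
have word k : well_preorder (ord k) by exact: well_preorder_lex_ranks.
have /choice[h hP] (x : A * S) : exists z, (exists2 z', I z' & pos z' = x) ->
    [/\ I z, pos z = x & forall z', I z' -> pos z' = x -> ord 0 z z'].
  have [ex|nex] := pselect (exists2 z', I z' & pos z' = x); last by exists z0.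
  have [|z [Iz pz] zmin] := (word 0).2 (fun z => I z /\ pos z = x).
    by case: ex => z Iz pz; exists z.
  by exists z => _; split=> // z' Iz' pz'; exact: zmin.
(* Moves preserve the second clause because they lead to successors, and the root is the successor
   of no node. *)
pose alive a s := (exists2 z, I z & pos z = (a, s)) /\ (s = tree_root M -> a = init AA).
pose le k x y := ord k (h x) (h y).
have Uex a s : exists U : A -> set (succ s), alive a s ->
    sat1 (restr (succ_supports s)) U (delta a (colour s)) /\
    forall b t, U b t -> [/\ alive b (val t),
              forall k, Omega a <= k -> le k (b, val t) (a, s)
            & odd (Omega a) -> ~ le (Omega a) (a, s) (b, val t)].
  have [[ex sroot]|nal] := pselect (alive a s); last by exists (fun _ => set0).
  have [Iz pz _] := hP _ ex; have := UP _ Iz; have prz : pr (h (a, s)) = Omega a.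
    by rewrite /pr pz.
  rewrite pz => -[U satU UE]; exists U => _; split=> // b t Ubt.
  have [z' [Iz' Szz' pz']] := UE b t Ubt.
  have Ezz' : E (h (a, s)) z' by [].
  have ex' : exists2 z, I z & pos z = (b, val t) by exists z'.
  have [_ _ /(_ _ Iz' pz') min0] := hP _ ex'.
  have mink k : ord k (h (b, val t)) z' by exact: rank_order_coarsen.
  split=> [|k ak|oa].
  - split=> // troot; have [_ noroot _] := succ_tree M.
    by case: (noroot s); rewrite -troot; exact: set_valP.
  - apply: (word k).1 (mink k) _; apply: rank_order_edge => //.
    by rewrite prz.
  have nle := @rank_order_odd_edge _ E pr D prD Epar _ _ _ Ezz' prz oa.
  by move=> lek; apply: nle; exact: (word _).1 lek (mink _).
exists alive, (fun a s => sval (cid (Uex a s))), le; split.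
- by move=> k; exact: (well_preorder_preimage (word k) h).
- by split=> //; exists z0.
- by move=> a [_]; exact.
by move=> a s; have := svalP (cid (Uex a s)).
Qed.

End Measure.

Lemma card_lt (A : finType) (Q Q' : {pred A}) (b : A) :
  {subset Q <= Q'} -> b \in Q' -> b \notin Q -> #|Q| < #|Q'|.
Proof.
move=> QQ' bQ' bQ; apply: proper_card; apply/properP; split; last by exists b.
exact/fintype.subsetP.
Qed.

(** * States and transitions *)

Section SimulatingAutomaton.
Variables (T : set_functor) (Lam : lifting_set T) (Aux : eqType) (Var : Type).
Hypothesis Aux_infinite : infinite_set [set: Aux].
Variables (P : set Var) (AA : automaton Lam Aux P).
Local Notation A := (state AA).

Definition index_bound : nat := (\max_(a : A) Omega a).+1.
Local Notation K := 'I_index_bound.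
Local Notation rank := 'I_(#|A|.+1).
Local Notation B := (K * rank)%type.
Local Notation m := #|{: B}|.

(** In order: edges from the states at the parent, ranks of states for each [k], the maps on
    positions, their flashes, the appearance record and the priority. Edges, maps, flashes and
    priority concern the step from the parent. *)
Definition sim_state : finType :=
  ({ffun A * A -> bool} * {ffun K * A -> rank} * {ffun B -> rank} *
   {ffun B -> bool} * {ffun B -> 'I_m} * 'I_(m.*2.+3))%type.

Implicit Types (q : sim_state) (a b : A).

Definition edge q a b : bool := q.1.1.1.1.1 (a, b).
Definition state_rank q (k : K) a : rank := q.1.1.1.1.2 (k, a).
Definition shift q (x : B) : rank := q.1.1.1.2 x.
Definition flash q (x : B) : bool := q.1.1.2 x.
Definition age q (x : B) : 'I_m := q.1.2 x.
Definition prio q : nat := q.2.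

Definition active q a : bool := [exists a0, edge q a0 a].

Definition move q (x : B) : B := (x.1, shift q x).

(* The state q' guessed at a child describes how the states tracked at the
   child compare, for every odd k, with those tracked by q at its parent. *)
Definition compatible q q' : Prop :=
  [/\ forall a b (k : K), edge q' a b -> Omega a <= k ->
        state_rank q' k b <= shift q' (k, state_rank q k a) /\
        (odd k -> Omega a = k ->
           state_rank q' k b < shift q' (k, state_rank q k a) \/
           flash q' (k, state_rank q k a)),
      forall (k : K) (i j : rank), i <= j -> shift q' (k, i) <= shift q' (k, j),
      forall (k : K) (i j : rank),
        ~ flash q' (k, j) -> i < j -> shift q' (k, i) < shift q' (k, j)
    & record_step (age q) (move q') (flash q') (age q') (prio q')].

Definition sim_delta q (c : set P) : so1 Lam Aux sim_state :=
  sval (cid (simulation_formula Aux_infinite (active q)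
    (fun q' => `[< compatible q q' >]) (fun q' => edge q')
    (fun a => delta a c))).

Lemma sim_deltaP q c (X : Sets) (alpha : T X) (V : sim_state -> set X) :
  sat1 alpha V (sim_delta q c) <->
    [/\ forall u v, u <> v -> V u `&` V v = set0,
        forall u x, V u x -> `[< compatible q u >]
      & forall a, active q a -> exists2 U : A -> set X,
          sat1 alpha U (delta a c) &
          forall b x, U b x -> exists2 u, edge u a b & V u x].
Proof. by rewrite /sim_delta; case: cid => f /= ->. Qed.

(** The root has no parent: a fictitious loop makes the initial state the only active one. Its rank
    is 1 because ranks count the state itself. *)
Definition sim_init : sim_state :=
  ([ffun x => x == (init AA, init AA)], [ffun => inord 1], [ffun => ord0],
   [ffun => false], [ffun x => enum_rank x], ord0).

Definition simulation : automaton Lam Aux P :=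
  Automaton sim_delta prio sim_init.

Lemma simulation_nondeterministic : nondeterministic simulation.
Proof.
move=> q c X alpha V satV; have /sim_deltaP[disj _ _] := satV.
by exists V; split=> // a; exact: subset_refl.
Qed.

Lemma active_init a : active sim_init a = (a == init AA).
Proof.
apply/existsP/eqP => [[a0]|->]; first by rewrite /edge ffunE => /eqP[].
by exists (init AA); rewrite /edge ffunE.
Qed.

Lemma Omega_index a : Omega a < index_bound.
Proof. by rewrite ltnS; exact: leq_bigmax. Qed.

Section Model.
Variable M : tree_model T Var.

(** A branch of the run for [AA] tracks one active state per node. Were an odd [k] its greatest
    recurrent priority, the ranks of these states would yield a token through [recurrent_flash] that
    contradicts [record_sound]. *)
Lemma simulation_sound : accepts simulation M -> accepts AA M.
Proof.
move=> /accepts_run[Z [pos [I [S [z0 [I0 pos0 UP par]]]]]].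
pose st z : sim_state := (pos z).1.
apply: (@run_accepts _ _ _ _ _ _ _ (Z * A)%type
  (fun x => (x.2, (pos x.1).2))
  (fun x => I x.1 /\ active (st x.1) x.2)
  (fun x y => [/\ S x.1 y.1, compatible (st x.1) (st y.1)
                & edge (st y.1) x.2 y.2])
  (z0, init AA)); split=> /=.
- by split=> //; rewrite /st pos0 active_init.
- by rewrite pos0.
- move=> [z a] /= [Iz act]; have [V /sim_deltaP[_ Vc Va] VE] := UP z Iz.
  have [U satU UV] := Va a act; exists U => // b t Ubt.
  have [u uab Vut] := UV b t Ubt; have [z' [Iz' Szz' pz']] := VE u t Vut.
  have su : st z' = u by rewrite /st pz'.
  exists (z', b); rewrite su pz'; split=> //=.
    by split=> //; apply/existsP; exists a.
  by split=> //; exact/asboolP/(Vc u t).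
move=> xs xsP; pose q j := st (xs j).1; pose a j := (xs j).2.
have comp j : compatible (q j) (q j.+1) by have [_ []] := xsP j.
have edges j : edge (q j.+1) (a j) (a j.+1) by have [_ []] := xsP j.
apply: (parity_seqP (fun i => Omega_index _)) => k N ok rk leN.
have kD : k < index_bound by have [j _ <-] := rk 0; exact: Omega_index.
pose k' : K := Ordinal kD.
pose g j i := shift (q j.+1) (k', i).
have [s [x rF]] : exists s x,
    recurrent (fun c => flash (q (s + c).+1) (k', token g s x c)).
  apply: (@recurrent_flash _ g (fun j i => flash (q j.+1) (k', i))
           (fun j => state_rank (q j) k' (a j)) _ _ N).
  - by move=> j i i'; have [_ + _ _] := comp j; apply.
  - by move=> j i i'; have [_ _ + _] := comp j; apply.
  - by move=> j Nj; have [/(_ _ _ k' (edges j) (leN j Nj))[]] := comp j.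
  move=> n; have [j nj Oj] := rk n; exists j => //.
  have Oj' : Omega (a j) <= k' by rewrite Oj.
  by have [/(_ _ _ k' (edges j) Oj')[_ /(_ ok Oj)]] := comp j.
have tokE c : token (fun j => move (q j.+1)) s (k', x) c = (k', token g s x c).
  by elim: c => //= c ->.
apply: (@record_sound _ (fun j => age (q j)) (fun j => move (q j.+1))
  (fun j => flash (q j.+1)) (fun j => prio (q j.+1)) m.*2.+3 s (k', x)).
- by move=> j; have [] := comp j.
- by move=> j; exact: ltn_ord.
- apply/(parity_seq_shift (fun j => prio (q j)) 1); apply: (par (fun j => (xs j).1)).
  by move=> j; have [[? _] []] := xsP j.
by move=> n; have [c nc Fc] := rF n; exists c => //; rewrite tokE.
Qed.

(** * Completeness: guesses read off a progress measure *)

Section Complete.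
Variables (alive : A -> carrier M -> Prop).
Variable U : A -> forall s : carrier M, A -> set (succ s).
Arguments U : clear implicits.
Variable le : nat -> A * carrier M -> A * carrier M -> Prop.
Hypothesis meas : progress_measure alive U le.

Let le_wo k : well_preorder (le k). Proof. by have [] := meas. Qed.
Let le_trans k x y z : le k x y -> le k y z -> le k x z.
Proof. exact: (le_wo k).1. Qed.
Let le_refl k x : le k x x. Proof. exact: well_preorder_refl (le_wo k) _. Qed.

Definition lower (s : carrier M) (k : nat) (a : A) : {pred A} :=
  [pred b | `[< alive b s /\ le k (b, s) (a, s) >]].
Definition rho s k a : nat := #|lower s k a|.

(** A lower set among the alive states at [t], so its size, if positive, is the rank of a greatest
    member. This size is the truthful guess for [shift]. *)
Definition reach (s t : carrier M) (k i : nat) : {pred A} :=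
  [pred b | `[< alive b t /\
    exists x, [/\ alive x s, rho s k x <= i & le k (b, t) (x, s)] >]].
Definition next_rank s t k i : nat := #|reach s t k i|.

(** A token at [i] can keep its value only through an equivalent state at [t]; failing that, it
    flashes. Position 0 lies below all alive states and never flashes. *)
Definition drops (s t : carrier M) (k i : nat) : Prop :=
  0 < i /\ ~ exists x b, [/\ alive x s, alive b t, rho s k x = i,
                             le k (b, t) (x, s) & le k (x, s) (b, t)].

Lemma lowerP s k a b : reflect (alive b s /\ le k (b, s) (a, s)) (b \in lower s k a).
Proof. by rewrite inE; exact: asboolP. Qed.

Lemma reachP s t k i b : reflect
  (alive b t /\ exists x, [/\ alive x s, rho s k x <= i & le k (b, t) (x, s)])
  (b \in reach s t k i).
Proof. by rewrite inE; exact: asboolP. Qed.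

Lemma rho_gt0 s k a : alive a s -> 0 < rho s k a.
Proof. by move=> al; apply/card_gt0P; exists a; apply/lowerP. Qed.

(** Lower sets of a total preorder are nested, so their inclusion amounts to a comparison of
    sizes. *)
Lemma le_rho s k a b : alive a s -> alive b s ->
  le k (a, s) (b, s) <-> rho s k a <= rho s k b.
Proof.
move=> ala alb; split=> [lab|].
  apply: subset_leq_card; apply/fintype.subsetP => c /lowerP[alc lca].
  by apply/lowerP; split=> //; exact: le_trans lab.
apply: contraPP => nab; apply/negP; rewrite -ltnNge.
have lba : le k (b, s) (a, s).
  by case: (well_preorder_total (le_wo k) (b, s) (a, s)).
apply: (@card_lt _ _ _ a); [|exact/lowerP|by apply/lowerP => -[_ /nab]].
by move=> c /lowerP[alc lcb]; apply/lowerP; split=> //; exact: le_trans lba.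
Qed.

Lemma next_rank_homo s t k i j : i <= j -> next_rank s t k i <= next_rank s t k j.
Proof.
move=> ij; apply: subset_leq_card; apply/fintype.subsetP => b.
move=> /reachP[alb [x [alx xi lbx]]]; apply/reachP; split=> //; exists x.
by split=> //; exact: leq_trans ij.
Qed.

(** Without a drop, some [b] at [t] is equivalent to a state of rank [j]; it is counted for [j] but
    not for [i]. *)
Lemma next_rank_lt s t k i j : ~ drops s t k j -> i < j ->
  next_rank s t k i < next_rank s t k j.
Proof.
move=> ndrop ij; have [x [b [alx alb xj lbx lxb]]] : exists x b,
    [/\ alive x s, alive b t, rho s k x = j, le k (b, t) (x, s)
      & le k (x, s) (b, t)].
  by apply: contrapT => nex; apply: ndrop; split=> //; exact: leq_ltn_trans ij.
apply: (@card_lt _ _ _ b).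
- move=> c /reachP[alc [y [aly yi lcy]]]; apply/reachP; split=> //; exists y.
  by split=> //; apply: leq_trans yi _; exact: ltnW.
- by apply/reachP; split=> //; exists x; rewrite xj.
apply/reachP => -[_ [y [aly yi lby]]].
have /(le_rho k alx aly) : le k (x, s) (y, s) by exact: le_trans lby.
by rewrite xj leqNgt (leq_ltn_trans yi ij).
Qed.

Lemma rho_move s (t : succ s) k a b : alive a s -> U a s b t -> Omega a <= k ->
  rho (val t) k b <= next_rank s (val t) k (rho s k a).
Proof.
move=> ala Ubt ak; have [_ _ _ /(_ a s ala)[_ /(_ b t Ubt)[alb lba _]]] := meas.
apply: subset_leq_card; apply/fintype.subsetP => c /lowerP[alc lcb].
by apply/reachP; split=> //; exists a; split=> //; exact: le_trans lcb (lba k ak).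
Qed.

(** Without a drop, some [c] at the child is equivalent to [a]; it is counted by [next_rank] but is
    not below [b], since the move to [b] descends strictly. *)
Lemma rho_odd_move s (t : succ s) a b : alive a s -> U a s b t ->
  odd (Omega a) ->
  rho (val t) (Omega a) b < next_rank s (val t) (Omega a) (rho s (Omega a) a) \/
  drops s (val t) (Omega a) (rho s (Omega a) a).
Proof.
move=> ala Ubt oa; have [_ _ _ /(_ a s ala)[_ /(_ b t Ubt)[alb lba nab]]] := meas.
have [|ndrop] := pselect (drops s (val t) (Omega a) (rho s (Omega a) a)).
  by right.
have [x [c [alx alc xa lcx lxc]]] : exists x c,
    [/\ alive x s, alive c (val t), rho s (Omega a) x = rho s (Omega a) a,
      le (Omega a) (c, val t) (x, s) & le (Omega a) (x, s) (c, val t)].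
  by apply: contrapT => nex; apply: ndrop; split=> //; exact: rho_gt0.
have lax : le (Omega a) (a, s) (x, s) by apply/le_rho => //; rewrite xa.
left; apply: (@card_lt _ _ _ c).
- move=> d /lowerP[ald ldb]; apply/reachP; split=> //; exists a; split=> //.
  exact: le_trans ldb (lba _ (leqnn _)).
- by apply/reachP; split=> //; exists x; rewrite xa.
by apply/lowerP => -[_ lcb]; apply: nab (oa) _; apply: le_trans lax (le_trans lxc lcb).
Qed.

Lemma next_rank_realized s t k i : 0 < next_rank s t k i -> exists b,
  [/\ alive b t, rho t k b = next_rank s t k i
    & exists x, [/\ alive x s, rho s k x <= i & le k (b, t) (x, s)]].
Proof.
move=> /card_gt0P[b0 b0r].
have [b br bmax] := @arg_maxnP _ b0 (mem (reach s t k i)) (rho t k) b0r.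
have /reachP[alb [x [alx xi lbx]]] : b \in reach s t k i by [].
exists b; split=> //; last by exists x.
apply: eq_card => c; apply/lowerP/reachP => [[alc lcb]|[alc Ec]].
  by split=> //; exists x; split=> //; exact: le_trans lbx.
by split=> //; apply/le_rho => //; apply: bmax; apply/reachP.
Qed.

(* A token follows positions of non-increasing value, and its flashes are strict
   descents. *)
Lemma not_recurrent_drops (s : nat -> carrier M) k (i : nat -> nat) :
  (forall c, i c.+1 = next_rank (s c) (s c.+1) k (i c)) ->
  ~ recurrent (fun c => drops (s c) (s c.+1) k (i c)).
Proof.
move=> iS rdrops.
(* Position 0 is never left and never flashes. *)
have i_gt0 c : 0 < i c.
  rewrite lt0n; apply/eqP => ic0.
  have i0 d : i (c + d) = 0.
    elim: d => [|d IH]; rewrite ?addn0 // addnS iS IH; apply: eq_card0 => b.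
    by apply/reachP => -[_ [x [/rho_gt0-/(_ k) + + _]]]; lia.
  by have [d cd []] := rdrops c; rewrite -(subnKC cd) i0.
have step c := @next_rank_realized (s c) (s c.+1) k (i c).
(* The token is realized by states from time 1 on, whatever [i 0] is; hence the shift by one. *)
have /choice[y yP] c : exists b, alive b (s c.+1) /\ rho (s c.+1) k b = i c.+1.
  by have [|b []] := step c; rewrite -iS => // *; exists b.
pose z c := (y c, s c.+1).
have zS c : le k (z c.+1) (z c) /\
    (drops (s c.+1) (s c.+2) k (i c.+1) -> ~ le k (z c) (z c.+1)).
  have [aly ry] := yP c; have [aly' ry'] := yP c.+1.
  have [|b [alb rb [x [alx xi lbx]]]] := step c.+1; first by rewrite -iS.
  have lyx : le k (z c.+1) (b, s c.+2) by apply/le_rho => //; rewrite ry' rb iS.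
  have lxy : le k (x, s c.+1) (z c) by apply/le_rho => //; rewrite ry.
  have lz : le k (z c.+1) (z c) := le_trans lyx (le_trans lbx lxy).
  by split=> // -[_ nex] lz'; apply: nex; exists (y c), (y c.+1).
have zD c d : le k (z (c + d)) (z c).
  elim: d => [|d IH]; rewrite ?addn0 ?addnS; first exact: le_refl.
  by apply: le_trans IH; have [] := zS (c + d).
(* After a least [z c], a further flash would be a descent below the least value. *)
have [|_ [c ->] cmin] := (le_wo k).2 (fun x => exists c, x = z c).
  by exists (z 0), 0.
have [d cd dd] := rdrops c.+1; case: d cd dd => // d cd dd.
have [_ /(_ dd)] := zS d; apply.
apply: le_trans (cmin _ (ex_intro _ d.+1 erefl)).
by rewrite -(subnKC (_ : c <= d)).
Qed.

Definition next_state (q : sim_state) s (t : succ s) (q' : sim_state) : Prop :=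
  [/\ forall a b, edge q' a b = active q a && `[< U a s b t >],
      forall k b, state_rank q' k b = rho (val t) k b :> nat
    & forall (k : K) (i : rank),
        shift q' (k, i) = next_rank s (val t) k i :> nat /\
        flash q' (k, i) = `[< drops s (val t) k i >]] /\
  [/\ injective (age q'), record_step (age q) (move q') (flash q') (age q') (prio q'),
      odd (prio q') -> exists2 x, flash q' x & prio q' = weight (age q x)
    & forall x, prio q' <= weight (age q x) -> age q' (move q' x) = age q x].

Lemma next_ex q s (t : succ s) : injective (age q) -> exists q', next_state q t q'.
Proof.
move=> inj_q; have cardA (Q : {pred A}) : #|Q| < #|A|.+1 by rewrite ltnS max_card.
pose sh (x : B) : rank := Ordinal (cardA (reach s (val t) x.1 x.2)).
pose fl (x : B) : bool := `[< drops s (val t) x.1 x.2 >].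
have [ag [p [ag_inj st p_lt p_odd p_keep]]] :=
  @record_next _ (age q) (fun x => (x.1, sh x)) fl inj_q.
exists ([ffun x : A * A => active q x.1 && `[< U x.1 s x.2 t >]],
  [ffun x : K * A => Ordinal (cardA (lower (val t) x.1 x.2))], [ffun x => sh x],
  [ffun x => fl x], [ffun x => ag x], Ordinal p_lt).
set q' : sim_state := (_, _, _, _, _, _).
have shE : shift q' =1 sh by move=> x; rewrite /shift ffunE.
have flE : flash q' =1 fl by move=> x; rewrite /flash ffunE.
have agE : age q' =1 ag by move=> x; rewrite /age ffunE.
have mvE : move q' =1 fun x => (x.1, sh x) by move=> x; rewrite /move shE.
split; split.
- by move=> a b; rewrite /edge ffunE.
- by move=> k b; rewrite /state_rank ffunE.
- by move=> k i; rewrite shE flE.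
- by move=> x y; rewrite !agE; exact: ag_inj.
- by move=> x; rewrite mvE flE agE; exact: st.
- by move=> /p_odd[x fx px]; exists x; rewrite ?flE.
by move=> x px; rewrite mvE agE; exact: p_keep.
Qed.

Definition faithful (q : sim_state) s : Prop :=
  [/\ forall a, active q a -> alive a s,
      forall (k : K) a, active q a -> state_rank q k a = rho s k a :> nat
    & injective (age q)].

Lemma next_faithful q s (t : succ s) q' :
  faithful q s -> next_state q t q' -> faithful q' (val t).
Proof.
move=> [al _ _] [[eq' rq' _] [inj' _ _ _]]; split=> // a.
move=> /existsP[a0]; rewrite eq' => /andP[/al al0 /asboolP Ua].
by have [_ _ _ /(_ _ _ al0)[_ /(_ _ _ Ua)[]]] := meas.
Qed.

Lemma next_compatible q s (t : succ s) q' :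
  faithful q s -> next_state q t q' -> compatible q q'.
Proof.
move=> [al rk _] [[eq' rq' sq'] [_ st' _ _]]; split=> //.
- move=> a b k; rewrite eq' => /andP[act /asboolP Uab] ak.
  have [shE flE] := sq' k (state_rank q k a).
  rewrite rq' shE rk //; split; first by apply: rho_move => //; exact: al.
  move=> ok ka; rewrite flE rk // -ka; rewrite -ka in ok.
  by have [lt|dr] := rho_odd_move (al _ act) Uab ok; [left|right; exact/asboolP].
- by move=> k i j ij; rewrite !(sq' _ _).1; exact: next_rank_homo.
move=> k i j nfl ij; have [-> _] := sq' k i; have [-> flj] := sq' k j.
by apply: next_rank_lt ij => dr; apply: nfl; rewrite flj; exact/asboolP.
Qed.

(** The guesses are made truthfully at every node. Since [not_recurrent_drops] excludes tokens with
    infinitely many flashes, [record_complete] gives the parity condition. *)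
Lemma simulation_complete : accepts simulation M.
Proof.
have [_ alive0 alive_root alP] := meas.
have /choice[nx nxP] (x : {s : carrier M & (sim_state * succ s)%type}) :
    exists q', injective (age (projT2 x).1) -> next_state (projT2 x).1 (projT2 x).2 q'.
  have [inj_q|ninj] := pselect (injective (age (projT2 x).1)).
    by have [q' q'P] := next_ex (projT2 x).2 inj_q; exists q'.
  by exists sim_init.
apply: (@run_accepts _ _ _ _ _ simulation M (sim_state * carrier M)%type id
  (fun x => faithful x.1 x.2)
  (fun x y => exists2 t : succ x.2, val t = y.2 & next_state x.1 t y.1)
  (sim_init, tree_root M)); split=> //=.
- split=> [a|k a|x y].
  + by rewrite active_init => /eqP->.
  + rewrite active_init => /eqP->; rewrite /state_rank ffunE /=.
    rewrite inordK; last by rewrite ltnS; apply/card_gt0P; exists (init AA).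
    rewrite -(card1 (init AA)); apply: eq_card => b; rewrite [LHS]inE.
    by apply/eqP/lowerP => [->|[/alive_root]].
  by rewrite /age !ffunE; exact: enum_rank_inj.
- move=> [q s] /= fq; have [al _ inj_q] := fq.
  pose nxt t := nx (existT (fun s => (sim_state * succ s)%type) s (q, t)).
  have nxtP t : next_state q t (nxt t) := nxP (existT _ s (q, t)) inj_q.
  (* Each child carries exactly one state, which makes the sets of the valuation disjoint. *)
  exists (fun q' => [set t | q' = nxt t]); last first.
    move=> q' t /= ->; exists (nxt t, val t); split=> //=.
      exact: next_faithful (nxtP t).
    by exists t.
  apply/sim_deltaP; split=> [u v uv|u t /= ->|a act].
  + by rewrite -subset0 => t [/= ut vt]; case: uv; rewrite ut vt.
  + by apply/asboolP; exact: next_compatible (nxtP t).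
  have [satU _] := alP a s (al a act); exists (U a s) => // b t Ubt.
  exists (nxt t) => //; have [[-> _ _] _] := nxtP t.
  by rewrite act; exact/asboolP.
move=> xs xsP; pose q j := (xs j).1; pose s j := (xs j).2.
have nextq j : exists2 t : succ (s j), val t = s j.+1 & next_state (q j) t (q j.+1).
  by have [] := xsP j.
(* The priority of the step from [q j] is stored in [q j.+1]. *)
apply/(parity_seq_shift (fun j => prio (q j)) 1).
apply: (@record_complete _ (fun j => age (q j)) (fun j => move (q j.+1))
  (fun j => flash (q j.+1))).
- by move=> j; have [[]] := xsP j.
- by move=> j; exact: ltn_ord.
- by move=> j; have [t _ [_ []]] := nextq j.
- by move=> j; have [t _ [_ []]] := nextq j.
move=> j0 [k i] rF; pose tok := token (fun j => move (q j.+1)) j0 (k, i).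
have tok1 c : (tok c).1 = k by rewrite /tok; elim: c.
have tokE c : tok c = (k, (tok c).2) by rewrite -(tok1 c); case: (tok c).
have shE j (x : rank) : shift (q j.+1) (k, x) = next_rank (s j) (s j.+1) k x :> nat /\
    flash (q j.+1) (k, x) = `[< drops (s j) (s j.+1) k x >].
  by have [t <- [[_ _ /(_ k x)]]] := nextq j.
apply: (@not_recurrent_drops (fun c => s (j0 + c)) k (fun c => (tok c).2)).
  by move=> c; rewrite /tok /= -/(tok c) tokE /= addnS; have [] := shE (j0 + c) (tok c).2.
move=> n; have [c nc Fc] := rF n; exists c => //; apply/asboolP.
by rewrite addnS -(shE _ _).2 -tokE.
Qed.

End Complete.

Lemma simulation_accepts : accepts simulation M <-> accepts AA M.
Proof.
split; first exact: simulation_sound.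
by move=> /accepts_measure[alive [U [le]]]; exact: simulation_complete.
Qed.

End Model.
End SimulatingAutomaton.

Theorem theorem4p20 (T : set_functor) (Lam : lifting_set T)
    (Lam_monotone : forall l : Lam, monotone_lifting (lifting l))
    (Var : Type) (Var_infinite : infinite_set [set: Var])
    (Aux : eqType) (Aux_infinite : infinite_set [set: Aux])
    (P : set Var) (P_finite : finite_set P)
    (AA : automaton Lam Aux P) (AA_monotone : monotone_automaton AA) :
  exists AA' : automaton Lam Aux P,
    nondeterministic AA' /\
    forall M : tree_model T Var, accepts AA' M <-> accepts AA M.
Proof.
exists (simulation Aux_infinite AA); split.
  exact: simulation_nondeterministic.
by move=> M; exact: simulation_accepts.
Qed.
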